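(* Suppose that the true function $f_0$ is in $H^\gamma(\mathbb{H}_1)$ for some $\gamma>0$ and that the problem is severely ill-posed with regularity $\beta$, i.e. there are constants $C_1,C_2,\beta,c_0>0$ and $\alpha_0,\alpha_1\in\mathbb{R}$ such that $C_1(1+k^2)^{-\alpha_0/2}e^{-c_0k^\beta}\le|\rho_k|\le C_2(1+k^2)^{-\alpha_1/2}e^{-c_0k^\beta}$ as $k\to\infty$. Let $\Pi$ be the sieve prior with truncation-level probability mass function $h$ and distribution function $H$, coefficient density $q$ and scales $\{\tau_k\}$. Suppose that $h(m)\ge B_1e^{-bm^{\beta+1}}$ for all $m\ge1$ and that $1-H(m)\le B_2\exp(-bm^{\beta+1})$ as $m\to\infty$, for some constants $B_1,B_2,b>0$. Suppose moreover that the density $q$ is standard Gaussian and that the scale parameters satisfy $\tau_k=(1+k^2)^{-\delta/2-1/4}$ for some $\delta>\beta/2$. Then for a sufficiently large constant $C>0$, $$\Pi\left(f\in\mathbb{H}_1:\|f-f_0\|_1>C(\log n)^{-\frac{(\delta-\beta/2)\wedge\gamma}{\beta}}\ \Big|\ Y\right)\to0$$ in $\mathbb{P}_{f_0}$-probability as $n\to\infty$.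
   Context: $\mathbb{H}_1,\mathbb{H}_2$ are separable Hilbert spaces with inner products $\langle\cdot,\cdot\rangle_i$ and norms $\|\cdot\|_i$, $i=1,2$. $A:\mathbb{H}_1\to\mathbb{H}_2$ is a known, injective, continuous linear operator with adjoint $A^*$. It is assumed throughout that there is an orthonormal basis $\{e_k\}_{k\ge 1}$ of $\mathbb{H}_1$ consisting of eigenvectors of $A^*A$, with $A^*Ae_k=\rho_k^2 e_k$ ($A$ need not be compact in general), and $\{g_k\}$ is the conjugate orthonormal system in $\mathbb{H}_2$ (an orthonormal basis of the range of $A$) defined by $Ae_k=\rho_k g_k$. Write $f_k=\langle f,e_k\rangle_1$, and $a\wedge b=\min(a,b)$. Model: for each $n\ge1$ one observes $Y=Y^{(n)}=Af+n^{-1/2}Z$, where $Z$ is Gaussian white noise on $\mathbb{H}_2$, interpreted as the Gaussian process $Y=(Y_h:h\in\mathbb{H}_2)$, $Y_h=\langle Af,h\rangle_2+n^{-1/2}Z_h$, where $(Z_h)$ is a mean-zero Gaussian process with $\mathbb{E}Z_hZ_{h'}=\langle h,h'\rangle_2$. Its law is denoted $\mathbb{P}_f$. Equivalently, one observes the independent variables $Y_k:=Y_{g_k}\sim N(\rho_kf_k,n^{-1})$, $k\ge1$. The data $Y$ are generated from $\mathbb{P}_{f_0}$. Posterior: for a prior $\Pi$ on a $\sigma$-algebra $\mathcal{B}$, with support $\mathcal{P}$, the posterior is (written for real scalars) $\Pi(B\mid Y)=\int_B e^{n\sum_k\rho_kf_kY_k-\frac n2\|Af\|_2^2}d\Pi(f)\big/\int_{\mathcal{P}}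 e^{n\sum_k\rho_kf_kY_k-\frac n2\|Af\|_2^2}d\Pi(f)$, $B\in\mathcal{B}$. Sobolev scale: for $s\ge0$, $H^s(\mathbb{H}_1)=\{f\in\mathbb{H}_1:\|f\|_{H^s}^2:=\sum_{k\ge1}|f_k|^2(1+k^2)^s<\infty\}$. Sieve prior: $\Pi$ is the law of $f=\sum_{k=1}^M f_ke_k$, where $M$ is an $\mathbb{N}$-valued random variable with probability mass function $h$ and distribution function $H$, and, given $M$, the $f_k$ are independent (real or complex as required) random variables with densities $\tau_k^{-1}q(\tau_k^{-1}\cdot)$, for a fixed density $q$ and a fixed sequence $\{\tau_k\}$ of positive scale parameters. That is, $\Pi=\sum_{m\ge1}h(m)\Pi_m$ with $\Pi_m(x_1,\dots,x_m)=\prod_{k=1}^m\tau_k^{-1}q(x_k/\tau_k)$. *)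

(* Defs.v *)
From HB Require Import structures.
From mathcomp Require Import all_boot all_order all_algebra sesquilinear.
From mathcomp Require Import all_classical all_reals all_analysis.
Set Implicit Arguments.
Unset Strict Implicit.
Unset Printing Implicit Defensive.
Import Order.TTheory GRing.Theory Num.Theory.
Import numFieldNormedType.Exports.
Local Open Scope classical_set_scope.
Local Open Scope ring_scope.

(* Real scalars throughout. Sequences that the mathematics indexes by k >= 1
   (e_k, g_k, rho_k, tau_k, f_k, Y_k) are indexed here by k : nat starting
   at 0, so that [e k] stands for e_{k+1}; accordingly k.+1 replaces k in
   explicit formulas. The truncation level M and its mass function h keep
   their original indexing m >= 1. *)

Section HilbertSpaces.
Context {R : realType}.

(* A real Hilbert space is a complete normed module whose norm is the one
   induced by a dot product. *)
Definition induces_norm (H : completeNormedModType R) (ip : {dot H for idfun}) :=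
  forall x : H, `|x| ^+ 2 = ip x x.

Definition separable_space (T : topologicalType) :=
  exists2 D : set T, countable D & dense D.

Definition orthonormal_basis (H : completeNormedModType R)
    (ip : {dot H for idfun}) (e : nat -> H) :=
  (forall j k, ip (e j) (e k) = (j == k)%:R) /\
  (forall f : H, (fun N => \sum_(k < N) ip f (e k) *: e k) @ \oo --> f).

Definition adjoint (H1 H2 : completeNormedModType R)
    (ip1 : {dot H1 for idfun}) (ip2 : {dot H2 for idfun})
    (A : H1 -> H2) (As : H2 -> H1) :=
  forall f g, ip2 (A f) g = ip1 f (As g).

Definition sobolev_norm2 (H : completeNormedModType R)
    (ip : {dot H for idfun}) (e : nat -> H) (s : R) (f : H) : \bar R :=
  (\sum_(0 <= k <oo)
     (`|ip f (e k)| ^+ 2 * (1 + k.+1%:R ^+ 2) `^ s)%:E)%E.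

Definition sobolev (H : completeNormedModType R)
    (ip : {dot H for idfun}) (e : nat -> H) (s : R) : set H :=
  [set f | (sobolev_norm2 ip e s f < +oo)%E].

Definition severely_ill_posed (rho : nat -> R) (beta : R) :=
  0 < beta /\
  exists C1 C2 c0 alpha0 alpha1 : R, [/\ 0 < C1, 0 < C2, 0 < c0 &
    \forall k \near \oo,
      C1 * (1 + k.+1%:R ^+ 2) `^ (- alpha0 / 2) * expR (- c0 * k.+1%:R `^ beta)
        <= `|rho k| /\
      `|rho k| <=
      C2 * (1 + k.+1%:R ^+ 2) `^ (- alpha1 / 2) * expR (- c0 * k.+1%:R `^ beta)].

End HilbertSpaces.

Definition borel (T : ptopologicalType) := g_sigma_algebraType (@open T).

Section Probability.
Context {R : realType}.
Local Open Scope ereal_scope.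

(* Possibly degenerate: [normal_prob m 0] is not the Dirac mass at m, so the
   zero-variance case is separate. *)
Definition gaussian d (W : measurableType d) (P : probability W R)
    (X : W -> R) :=
  (exists m : R, {ae P, forall w, X w = m}) \/
  (exists m s : R, s != 0%R /\
     forall B, measurable B -> P (X @^-1` B) = normal_prob m s B).

Definition gaussian_process d (W : measurableType d) (P : probability W R)
    (I : Type) (Z : I -> {RV P >-> R}) :=
  forall (n : nat) (a : 'I_n -> R) (t : 'I_n -> I),
    gaussian P (fun w => \sum_(i < n) a i * Z (t i) w)%R.

Definition white_noise d (W : measurableType d) (P : probability W R)
    (H : completeNormedModType R) (ip : {dot H for idfun})
    (Z : H -> {RV P >-> R}) :=
  [/\ gaussian_process Z,
      forall h, 'E_P[Z h] = 0 &
      forall h h', 'E_P[(fun w => Z h w * Z h' w)%R] = (ip h h')%:E].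

Definition observation d (W : measurableType d) (P : probability W R)
    (H : completeNormedModType R) (ip : {dot H for idfun})
    (Z : H -> {RV P >-> R}) (Af : H) (n : nat) (h : H) (w : W) : R :=
  (ip Af h + (Num.sqrt n%:R)^-1 * Z h w)%R.

Definition cvg0_in_probability d (W : measurableType d) (P : probability W R)
    (X : nat -> W -> \bar R) :=
  forall eps : R, (0 < eps)%R ->
    (fun n => P [set w | eps%:E < `|X n w|]) @ \oo --> 0.

End Probability.

Section Bayes.
Context {R : realType}.
Variables (H1 H2 : completeNormedModType R) (ip1 : {dot H1 for idfun}).

Definition topological_support (Pi : probability (borel H1) R) : set H1 :=
  [set f | forall U : set H1, open U -> U f -> (0 < Pi U)%E].

(* The series is a finite sum for f in the range of a sieve prior. On the
   null set of other f where it diverges, [limn] takes an arbitrary value. *)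
Definition likelihood (e : nat -> H1) (rho : nat -> R) (A : H1 -> H2)
    (n : nat) (Y : nat -> R) (f : H1) : R :=
  expR (n%:R * limn (fun N => \sum_(k < N) rho k * ip1 f (e k) * Y k)
        - n%:R / 2 * `|A f| ^+ 2).

Definition posterior (e : nat -> H1) (rho : nat -> R) (A : H1 -> H2)
    (n : nat) (Pi : probability (borel H1) R) (Y : nat -> R)
    (B : set H1) : \bar R :=
  ((\int[Pi]_(f in B) (likelihood e rho A n Y f)%:E) /
   (\int[Pi]_(f in topological_support Pi) (likelihood e rho A n Y f)%:E))%E.

Definition scaled_density (q : R -> R) (t : R) (x : R) : R :=
  t^-1 * q (t^-1 * x).

(* Pi is the law of \sum_(k < M) x_k e_k on an auxiliary space: M >= 1 has
   mass function h and, given M = m, the coefficients x_k, k < m, are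
   independent with densities tau_k^-1 q(tau_k^-1 .). *)
Definition sieve_prior (e : nat -> H1) (h : nat -> R) (q : R -> R)
    (tau : nat -> R) (Pi : probability (borel H1) R) :=
  exists (d : measure_display) (W : measurableType d) (Q : probability W R)
         (M : {RV Q >-> nat}) (x : nat -> {RV Q >-> R}),
  [/\ forall w, (0 < M w)%N,
      forall m, (0 < m)%N -> Q (M @^-1` [set m]) = (h m)%:E,
      forall (m : nat) (B : nat -> set R), (0 < m)%N ->
        (forall k, measurable (B k)) ->
        Q [set w | M w = m /\ forall k, (k < m)%N -> B k (x k w)] =
        ((h m)%:E * \prod_(k < m)
           \int[lebesgue_measure]_(y in B k) (scaled_density q (tau k) y)%:E)%E &
      forall B : set (borel H1), measurable B ->
        Pi B = Q [set w | B (\sum_(k < M w) x k w *: e k)]].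

End Bayes.

Definition distribution_function {R : realType} (h : nat -> R) (m : nat) : R :=
  \sum_(1 <= j < m.+1) h j.

(* Main.v *)
Require Import Defs.
From HB Require Import structures.
From mathcomp Require Import all_boot all_order all_algebra sesquilinear.
From mathcomp Require Import all_classical all_reals all_analysis.
From mathcomp Require Import measurable_realfun ring lra.
Import Order.TTheory GRing.Theory Num.Theory.
Import numFieldNormedType.Exports.
Local Open Scope classical_set_scope.
Local Open Scope ring_scope.
Set Implicit Arguments.
Unset Strict Implicit.
Unset Printing Implicit Defensive.

(** Why the theorem holds. The prior is a mixture over the truncation level m of
    Gaussian product laws on the first m coordinates, and the log-likelihood is
    a sum over coordinates of quadratic polynomials, so everything is conjugate.
    Write f_k for the coordinates of f0, xi_k for the noise Z_(g_k),
    a_k = n rho_k^2 tau_k^2 and r = (ln n)^(-p/beta), with p the minimum of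
    delta - beta/2 and gamma. On the level m the unnormalised posterior is
    h m * \prod_(k < m) Z_k times a product of Gaussian densities with explicit
    means and variances, where Z_k ([tilt_mass]) is the marginal likelihood of
    the coordinate k. Two estimates on these formulas suffice.

    First, given m, the posterior mean of |f - f0|^2 is at most
    12 \sum_(k < m) (tau_k^2 + f_k^2) / (1 + a_k) * (1 + xi_k^2), plus the
    squared bias [residual] of truncating f0 at m ([tilt_risk_le]). Take a level
    j of order (ln n)^(1/beta), with a small constant. For k < j the signal
    dominates: a_k is at least of order n^(1/2). For k >= j the sum of
    tau_k^2 + f_k^2 is the tail of a series that still converges with the
    weights (1 + k^2)^p, hence it is o(j^(-2p)) = o(r^2). So the sum has mean
    o(r^2) whatever m is, and Chebyshev's inequality settles every level m whose
    bias exceeds that of j by at most n^(-1/4); all m >= j are of this kind.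

    Second, the levels m < j with a larger bias miss signal that the data see.
    Unless the noise is exceptionally large, the factors Z_k, m <= k < j, multiply
    to at least the exponential of a power of n ([tilt_mass_ge], [prod_mass_ge]),
    whereas the lower bound on h j and the normalising factors (1 + a_k)^(-1/2)
    cost only the exponential of a power of ln n. Such levels weigh a negligible fraction of the level j.

    [integral_likelihood_far] adds up the levels for fixed data, and
    [truncation_level_exists] makes the choice of j and collects the limits.
    The noise is kept small by Markov's inequality, from E xi_k^2 = 1
    ([prob_weighted_squares_ge]). The bound holds for every C >= 1, because the
    tails are o(r^2) and not only O(r^2).

    The events whose probability is taken have to be measurable. The posterior
    is a quotient of integrals over the parameter, which depend measurably on
    the data by Tonelli's theorem ([measurable_integral_likelihood]): up to a
    null set the parameter has finitely many nonzero coordinates, and there the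
    series in the likelihood is a finite sum. *)

(** * Inner products and orthonormal coordinates *)

Section Hilbert.
Context {R : realType} {H : completeNormedModType R} (ip : {dot H for idfun}).

Lemma dotC x y : ip x y = ip y x.
Proof. by rewrite hermitian_subproof expr0 mul1r. Qed.

Lemma dotDl x y z : ip (x + y) z = ip x z + ip y z.
Proof. exact: linearDl. Qed.

Lemma dotZl a x z : ip (a *: x) z = a * ip x z.
Proof. exact: linearZl_LR. Qed.

Lemma dotDr x y z : ip z (x + y) = ip z x + ip z y.
Proof. exact: linearDr. Qed.

Lemma dotZr a x z : ip z (a *: x) = a * ip z x.
Proof. by rewrite dotC dotZl dotC. Qed.

Lemma dotNr x z : ip z (- x) = - ip z x.
Proof. exact: linearNr. Qed.

Lemma dot_suml n (x : 'I_n -> H) z :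
  ip (\sum_(k < n) x k) z = \sum_(k < n) ip (x k) z.
Proof. exact: linear_sumlz. Qed.

Lemma dot_sumr n (x : 'I_n -> H) z :
  ip z (\sum_(k < n) x k) = \sum_(k < n) ip z (x k).
Proof. exact: linear_sumr. Qed.

Hypothesis ip_norm : induces_norm ip.

Lemma sqr_normD x y : `|x + y| ^+ 2 = `|x| ^+ 2 + 2 * ip x y + `|y| ^+ 2.
Proof. by rewrite !ip_norm dotDl !dotDr (dotC y x); ring. Qed.

Lemma sqr_normB x y : `|x - y| ^+ 2 = `|x| ^+ 2 - 2 * ip x y + `|y| ^+ 2.
Proof. by rewrite sqr_normD dotNr normrN; ring. Qed.

(** By polarization the inner product is a polynomial in norms. *)
Lemma continuous_dot y : continuous (fun x : H => ip x y).
Proof.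
have -> : (fun x : H => ip x y) =
    (fun x => (`|x + y| ^+ 2 - `|x| ^+ 2 - `|y| ^+ 2) / 2).
  by apply/funext => x; rewrite sqr_normD; field.
move=> x; apply: cvgMl; apply: cvgB; last exact: cvg_cst.
by apply: cvgB; rewrite expr2; apply: cvgM;
  apply: cvg_norm => //; apply: cvgD => //; exact: cvg_cst.
Qed.

Variable e : nat -> H.
Hypothesis e_orth : forall j k, ip (e j) (e k) = (j == k)%:R.

Lemma dot_basis_comb m (x : nat -> R) k :
  ip (\sum_(i < m) x i *: e i) (e k) = if (k < m)%N then x k else 0.
Proof.
rewrite dot_suml; under eq_bigr do rewrite dotZl e_orth.
case: ifPn => [km|]; last first.
  rewrite -leqNgt => mk; apply: big1 => i _.
  by rewrite (negbTE (_ : i != k :> nat)) ?mulr0// neq_ltn (leq_trans _ mk).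
rewrite (bigD1 (Ordinal km))//= eqxx mulr1 big1 ?addr0// => i ik.
by rewrite (_ : (i == k :> nat) = false) ?mulr0//; apply/negbTE.
Qed.

(** The squared distance of f to the span of e_0, .., e_(m-1), written so that
    no infinite sum is involved. *)
Definition residual (f : H) m : R :=
  `|f| ^+ 2 - \sum_(k < m) ip f (e k) ^+ 2.

(** Pythagoras: the error of an m-term combination splits into the errors on
    the first m coordinates and the bias of truncation. *)
Lemma sqr_dist_comb m (x : nat -> R) (f : H) :
  `|\sum_(i < m) x i *: e i - f| ^+ 2 =
  \sum_(k < m) (x k - ip f (e k)) ^+ 2 + residual f m.
Proof.
rewrite sqr_normB ip_norm dot_sumr.
under eq_bigr => i _ do rewrite dotZr dot_basis_comb ltn_ord.
rewrite dot_suml; under [X in _ - 2 * X]eq_bigr => i _ do rewrite dotZl dotC.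
rewrite /residual addrCA addrC; congr (_ + _).
rewrite mulr_sumr -!sumrB; apply: eq_bigr => i _.
by ring.
Qed.

Lemma residualS f m : residual f m = residual f m.+1 + ip f (e m) ^+ 2.
Proof. by rewrite /residual big_ord_recr/=; ring. Qed.

Lemma residual_ge0 f m : 0 <= residual f m.
Proof.
have := sqr_dist_comb m (fun k => ip f (e k)) f.
rewrite [X in _ = X + _]big1 ?add0r => [<-|i _]; last by rewrite subrr expr0n.
exact: sqr_ge0.
Qed.

Lemma residual_sum f m j : (m <= j)%N ->
  residual f m = residual f j + \sum_(m <= k < j) ip f (e k) ^+ 2.
Proof.
elim: j => [|j IH]; first by rewrite leqn0 => /eqP ->; rewrite big_geq// addr0.
rewrite leq_eqVlt => /predU1P[->|]; first by rewrite big_geq// addr0.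
by rewrite ltnS => mj; rewrite big_nat_recr//= IH// residualS; ring.
Qed.

Lemma residual_le f m j : (m <= j)%N -> residual f j <= residual f m.
Proof.
move=> mj; rewrite (residual_sum f mj) lerDl.
by apply: sumr_ge0 => k _; exact: sqr_ge0.
Qed.

Lemma residual_cvg0 f :
  (fun N => \sum_(k < N) ip f (e k) *: e k) @ \oo --> f ->
  residual f @ \oo --> 0.
Proof.
move=> ef.
pose d N := `|\sum_(k < N) ip f (e k) *: e k - f|.
have -> : residual f = (fun N => d N * d N).
  apply/funext => m; rewrite -expr2 (sqr_dist_comb m (fun k => ip f (e k))).
  by rewrite [X in _ = X + _]big1 ?add0r// => i _; rewrite subrr expr0n.
have d0 : d @ \oo --> 0.
  have := cvg_norm (cvgB ef (cvg_cst f)); rewrite subrr normr0; exact.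
have := cvgM d0 d0; rewrite mulr0; exact.
Qed.

End Hilbert.

(** * Integrals against product densities *)

Section DensityTransfer.
Context {R : realType} d (T : measurableType d) (mu : {measure set T -> \bar R}).
Local Open Scope ereal_scope.
Import HBNNSimple.

(** If the X-image of the measure G mu on E is c times the density q on sets,
    the same holds on functions, by approximation with simple functions. *)
Lemma integral_density_transfer (E : set T) (X : T -> R) (G : T -> R)
    (q phi : R -> R) (c : R) :
  measurable E -> measurable_fun setT X ->
  measurable_fun setT G -> (forall t, 0 <= G t)%R ->
  measurable_fun setT q -> (forall y, 0 <= q y)%R ->
  measurable_fun setT phi -> (forall y, 0 <= phi y)%R ->
  (0 <= c)%R ->
  (forall A, measurable A ->
    \int[mu]_(t in E `&` X @^-1` A) (G t)%:E =
    c%:E * \int[lebesgue_measure]_(y in A) (q y)%:E) ->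
  \int[mu]_(t in E) (phi (X t) * G t)%:E =
  c%:E * \int[lebesgue_measure]_y (phi y * q y)%:E.
Proof.
move=> mE mX mG G0 mq q0 mphi phi0 c0 XG.
have mphi' : measurable_fun [set: R] (fun y : R => (phi y)%:E) by exact/measurable_EFinP.
pose f := nnsfun_approx measurableT mphi'.
have mf n : measurable_fun [set: R] (f n) by exact: measurable_funP.
have fphi y : (EFin \o f ^~ y) n @[n --> \oo] --> (phi y)%:E.
  by apply: (cvg_nnsfun_approx measurableT mphi') => // z _; rewrite lee_fin.
have fnd y : {homo (f ^~ y) : a b / (a <= b)%N >-> (a <= b)%R}.
  by move=> a b ab; exact/lefP/nd_nnsfun_approx.
have cvg_l : \int[mu]_(t in E) (f n (X t) * G t)%:E @[n --> \oo] -->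
    \int[mu]_(t in E) (phi (X t) * G t)%:E.
  rewrite (_ : (fun t => _) =
      (fun t => limn (fun n => (f n (X t) * G t)%:E))); last first.
    apply/funext => t; apply/esym/cvg_lim => //.
    under eq_fun do rewrite EFinM; rewrite EFinM.
    by apply: cvgeZr => //; exact: fphi.
  apply: cvg_monotone_convergence => //.
  - move=> n; apply/measurable_EFinP; apply: measurable_funTS.
    by apply: measurable_funM => //; exact: measurableT_comp.
  - by move=> n t _; rewrite lee_fin mulr_ge0.
  - by move=> t _ a b ab; rewrite lee_fin ler_wpM2r// fnd.
have cvg_r : \int[lebesgue_measure]_y (f n y * q y)%:E @[n --> \oo] -->
    \int[lebesgue_measure]_y (phi y * q y)%:E.
  rewrite (_ : (fun y => (phi y * q y)%:E) =
      (fun t => limn (fun n => (f n t * q t)%:E))); last first.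
    apply/funext => t; apply/esym/cvg_lim => //.
    under eq_fun do rewrite EFinM; rewrite EFinM.
    by apply: cvgeZr => //; exact: fphi.
  apply: cvg_monotone_convergence => //.
  - by move=> n; apply/measurable_EFinP/measurable_funM; [exact: mf|exact: mq].
  - by move=> n t _; rewrite lee_fin mulr_ge0.
  - by move=> t _ a b ab; rewrite lee_fin ler_wpM2r// fnd.
suff fE n : \int[mu]_(t in E) (f n (X t) * G t)%:E =
    c%:E * \int[lebesgue_measure]_y (f n y * q y)%:E.
  have := cvgeZl (isT : c%:E \is a fin_num) cvg_r.
  under eq_fun do rewrite -fE.
  by move=> cvg_c; exact: (cvg_unique _ cvg_l cvg_c).
have mfX y : measurable (X @^-1` (f n @^-1` [set y])).
  by rewrite -[_ @^-1` _]setTI; exact: mX.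
have mfR (y : R) : measurable (f n @^-1` [set y]) by exact: measurable_sfunP.
have mI (y : R) : measurable_fun [set: R] (fun z => y * \1_(f n @^-1` [set y]) z)%R.
  by apply: measurable_funM => //; exact: measurable_indic.
transitivity (\int[mu]_(t in E) (\sum_(y \in range (f n))
   (y * \1_(f n @^-1` [set y]) (X t) * G t)%:E)).
  apply: eq_integral => t _; rewrite fsumEFin//; congr EFin.
  by rewrite {1}fimfunE mulr_fsuml.
rewrite ge0_integral_fsum//; first last.
- move=> y t _; rewrite lee_fin mulr_ge0//.
  by rewrite -lee_fin; exact: nnfun_muleindic_ge0.
- move=> y; apply/measurable_EFinP; apply: measurable_funTS.
  apply: measurable_funM => //; apply: measurable_funM => //.
  by apply: measurableT_comp => //; exact: measurable_indic.
transitivity (c%:E * \int[lebesgue_measure]_z (\sum_(y \in range (f n))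
   (y * \1_(f n @^-1` [set y]) z * q z)%:E)); last first.
  congr (_ * _); apply: eq_integral => z _; rewrite fsumEFin//; congr EFin.
  by rewrite [in RHS]fimfunE mulr_fsuml.
rewrite ge0_integral_fsum//; first last.
- move=> y t _; rewrite lee_fin mulr_ge0//.
  by rewrite -lee_fin; exact: nnfun_muleindic_ge0.
- by move=> y; apply/measurable_EFinP/measurable_funM; [exact: mI|exact: mq].
rewrite ge0_mule_fsumr; last first.
  move=> y; apply: integral_ge0 => z _; rewrite lee_fin mulr_ge0//.
  by rewrite -lee_fin; exact: nnfun_muleindic_ge0.
apply: eq_fsbigr => y /[!inE] -[z _ fzy].
have y0 : (0 <= y)%R by rewrite -fzy.
under eq_integral do rewrite -mulrA EFinM.
rewrite ge0_integralZl//; last 2 first.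
- apply/measurable_EFinP; apply: measurable_funTS; apply: measurable_funM => //.
  by apply: measurableT_comp => //; exact: measurable_indic.
- by move=> t _; rewrite lee_fin mulr_ge0.
under [in RHS]eq_integral do rewrite -mulrA EFinM.
rewrite ge0_integralZl//; last 2 first.
- apply/measurable_EFinP/measurable_funM; last exact: mq.
  exact: (measurable_indic (mfR y)).
- by move=> t _; rewrite lee_fin mulr_ge0.
rewrite muleCA; congr (_ * _).
transitivity (\int[mu]_(t in E `&` X @^-1` (f n @^-1` [set y])) (G t)%:E).
  rewrite [RHS]integral_mkcondr epatch_indic; apply: eq_integral => t _ /=.
  by rewrite EFinM muleC.
rewrite XG//; congr (_ * _); rewrite [LHS]integral_mkcond epatch_indic.
by apply: eq_integral => u _ /=; rewrite EFinM muleC.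
Qed.

End DensityTransfer.

Section ProductIntegral.
Context {R : realType} d (T : measurableType d) (mu : {measure set T -> \bar R}).
Variables (E : set T) (x : nat -> T -> R) (q : nat -> R -> R) (m : nat) (c : R).
Hypothesis mE : measurable E.
Hypothesis mx : forall k, measurable_fun setT (x k).
Hypothesis mq : forall k, measurable_fun setT (q k).
Hypothesis q0 : forall k y, 0 <= q k y.
Hypothesis q1 : forall k, (\int[lebesgue_measure]_y (q k y)%:E = 1)%E.
Hypothesis c0 : 0 <= c.
Hypothesis law : forall B : nat -> set R, (forall k, measurable (B k)) ->
  mu [set t | E t /\ forall k, (k < m)%N -> B k (x k t)] =
  (c%:E * \prod_(k < m) \int[lebesgue_measure]_(y in B k) (q k y)%:E)%E.

Lemma integral_density_fin_num k (A : set R) : measurable A ->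
  (\int[lebesgue_measure]_(y in A) (q k y)%:E)%E \is a fin_num.
Proof.
move=> mA; rewrite ge0_fin_numE; last first.
  by apply: integral_ge0 => y _; rewrite lee_fin.
apply: (@le_lt_trans _ _ 1%E); last exact: ltry.
rewrite -(q1 k); apply: ge0_subset_integral => //.
- by apply/measurable_EFinP; exact: mq.
- by move=> y _; rewrite lee_fin.
Qed.

Lemma measurable_coord_event (B : nat -> set R) (P : pred nat) :
  (forall k, measurable (B k)) ->
  measurable [set t | E t /\ forall k, (k < m)%N -> P k -> B k (x k t)].
Proof.
move=> mB.
rewrite (_ : [set t | _] =
    E `&` \bigcap_(k in [set k | (k < m)%N && P k]) (x k @^-1` B k)); last first.
  apply/seteqP; split => [t [Et H]|t [Et H]]; split=> //.
    by move=> k /= /andP[]; exact: H.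
  by move=> k km Pk; apply: H => /=; rewrite km.
apply: measurableI => //; apply: bigcap_measurableType => k _.
by rewrite -[_ @^-1` _]setTI; exact: mx.
Qed.

Variables (phi : nat -> R -> R) (I : nat -> R).
Hypothesis mphi : forall k, measurable_fun setT (phi k).
Hypothesis phi0 : forall k y, 0 <= phi k y.
Hypothesis phiI : forall k, (k < m)%N ->
  (\int[lebesgue_measure]_y (phi k y * q k y)%:E = (I k)%:E)%E.

(** Sets are traded for functions one coordinate at a time: with the
    coordinates below j already carrying functions, the identity read as a
    function of the set B j alone is the hypothesis of the transfer lemma. *)
Lemma partial_product_integral j (B : nat -> set R) : (j <= m)%N ->
  (forall k, measurable (B k)) ->
  (\int[mu]_(t in [set t | E t /\ forall k, (k < m)%N -> (j <= k)%N ->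
      B k (x k t)]) (\prod_(k < j) phi k (x k t))%:E =
  (c * \prod_(k < j) I k)%:E *
    \prod_(j <= k < m) \int[lebesgue_measure]_(y in B k) (q k y)%:E)%E.
Proof.
elim: j B => [|j IH] B jm mB.
  under eq_integral do rewrite big_ord0.
  rewrite integral_cst; last exact: (measurable_coord_event (leq 0) mB).
  rewrite mul1e big_ord0 mulr1 big_mkord -law//; congr (mu _).
  by apply/seteqP; split => t [Et H]; split=> // k km *; exact: H.
pose F := [set t | E t /\ forall k, (k < m)%N -> (j < k)%N -> B k (x k t)].
pose p := (\prod_(j.+1 <= k < m) \int[lebesgue_measure]_(y in B k) (q k y)%:E)%E.
have p_fin : p \is a fin_num.
  by apply: prode_fin_num => k _; exact: integral_density_fin_num.
have p0 : (0 <= p)%E.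
  apply: prode_ge0 => k _; apply: integral_ge0 => y _; by rewrite lee_fin.
have I0 k : (k < m)%N -> 0 <= I k.
  move=> km; rewrite -lee_fin -phiI//; apply: integral_ge0 => y _.
  by rewrite lee_fin mulr_ge0.
have cI0 : 0 <= c * \prod_(k < j) I k.
  rewrite mulr_ge0// prodr_ge0// => k _; apply: I0.
  by rewrite (ltn_trans (ltn_ord k)).
have step := @integral_density_transfer R d T mu F (x j)
  (fun t => \prod_(k < j) phi k (x k t)) (q j) (phi j)
  (c * \prod_(k < j) I k * fine p).
under eq_integral do rewrite big_ord_recr/= mulrC.
rewrite step; last first.
- move=> A mA; pose B' k := if k == j then A else B k.
  have mB' k : measurable (B' k) by rewrite /B'; case: ifP.
  have := IH B' (ltnW jm) mB'.
  rewrite [X in (_ * X)%E]big_ltn// {2}/B' eqxx.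
  rewrite [X in (_ * (_ * X))%E](_ : _ = p); last first.
    by apply: eq_big_nat => k /andP[jk _]; rewrite /B' gtn_eqF.
  rewrite (EFinM _ (fine p)) fineK// -muleA (muleC p) => <-.
  congr (integral mu _ _); apply/seteqP; split => t.
    move=> [[Et H] At]; split=> // k km; rewrite /B' leq_eqVlt eq_sym.
    by case: eqP => [->//|_ /= jk]; exact: H.
  move=> [Et H]; split; last by have := H j jm (leqnn _); rewrite /B' eqxx.
  split=> // k km jk; have := H k km (ltnW jk).
  by rewrite /B' gtn_eqF.
- by rewrite mulr_ge0// fine_ge0.
- by [].
- by [].
- by [].
- by [].
- by move=> t; apply: prodr_ge0.
- by apply: measurable_prod => k _; exact: measurableT_comp.
- by [].
- exact: (measurable_coord_event (leq j.+1) mB).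
rewrite phiI// big_ord_recr/= mulrA (EFinM _ (fine p)) (EFinM _ (I j)) fineK//.
by rewrite -!muleA (muleC p).
Qed.

(** Fubini's theorem for coordinates whose joint law on E is given on product
    sets only. *)
Lemma product_integral :
  (\int[mu]_(t in E) (\prod_(k < m) phi k (x k t))%:E =
  (c * \prod_(k < m) I k)%:E)%E.
Proof.
have := partial_product_integral (leqnn m) (fun=> measurableT).
rewrite big_geq// mule1 => <-; congr (integral mu _ _).
by apply/seteqP; split => [t Et|t []].
Qed.

End ProductIntegral.

(** * Borel sets of a separable normed space *)

Section BorelSeparable.
Context {R : realType} {H : completeNormedModType R}.

Lemma measurable_open (U : set H) :
  open U -> measurable (U : set (borel H)).
Proof. exact: sub_sigma_algebra. Qed.

Lemma continuous_measurable_borel (f : H -> R) :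
  continuous f -> measurable_fun [set: borel H] f.
Proof.
move=> cf; apply: (measurability _ (RGenOInfty.measurableE R)) => //.
move=> _ [_ [a ->] <-]; rewrite setTI; apply: measurable_open.
by apply: open_comp => // x _; exact: cf.
Qed.

Lemma open_far (f0 : H) (r : R) : open [set f : H | r < `|f - f0|].
Proof.
rewrite (_ : [set f | _] = (fun f => `|f - f0|) @^-1` [set y | r < y])//.
apply: open_comp; last exact: open_gt.
by move=> f _; exact: (cvg_norm (cvgB cvg_id (cvg_cst f0))).
Qed.

Hypothesis H_separable : separable_space H.

Lemma dense_sequence : exists s : nat -> H,
  forall (x : H) (r : R), 0 < r -> exists n, `|x - s n| < r.
Proof.
have [D /countable_injP[f f_inj] D_dense] := H_separable.
exists (fun n => xget 0 [set c | D c /\ f c = n]) => x r r0.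
have [y [xy Dy]] : ball x r `&` D !=set0.
  by apply: D_dense; [exists x; exact: ballxx|exact: ball_open].
exists (f y); case: xgetP => [z _ [Dz fzy]|/(_ y)[]//].
have -> : z = y by apply: f_inj; rewrite ?inE.
by move: xy; rewrite -ball_normE.
Qed.

(** Second countability, in the form used below: one sequence of centres serves
    all open sets, with the radii 1 / (k + 1). *)
Lemma open_bigcup_balls : exists s : nat -> H, forall U : set H, open U ->
  U = \bigcup_n \bigcup_(k in [set k | [set y | `|s n - y| < k.+1%:R^-1] `<=` U])
        [set y | `|s n - y| < k.+1%:R^-1].
Proof.
have [s sd] := dense_sequence; exists s => U oU; apply/seteqP; split; last first.
  by move=> y [n _ [k kU]]; exact: kU.
move=> x Ux.
have /nbhs_ballP[r /= r0 rU] : nbhs x U by exact: open_nbhs_nbhs.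
have [k kr] : exists k, k.+1%:R^-1 < r / 2.
  exists (Num.bound (r / 2)^-1).
  rewrite invf_plt ?posrE ?divr_gt0// (lt_le_trans (archi_boundP _))//.
    by rewrite invr_ge0 divr_ge0// ltW.
  by rewrite ler_nat.
have [n xn] := sd x k.+1%:R^-1 (ltac:(by rewrite invr_gt0)).
exists n => //; exists k => /=; last by rewrite distrC.
move=> y /= ny; apply: rU; rewrite -ball_normE /=.
rewrite (le_lt_trans (ler_distD (s n) _ _))// (splitr r).
by rewrite ltrD// (lt_trans _ kr).
Qed.

(** Balls are sublevel sets of distances, and by the previous lemma countably
    many of them make up any open set. *)
Lemma measurable_fun_borel d (T : measurableType d) (f : T -> borel H) :
  (forall c : H, measurable_fun setT (fun t => `|c - (f t : H)|)) ->
  measurable_fun setT f.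
Proof.
move=> mf; apply: (@measurability _ _ T (borel H) setT f open erefl).
move=> _ [U oU <-]; rewrite setTI.
have [s /(_ _ oU) ->] := open_bigcup_balls.
rewrite preimage_bigcup; apply: bigcupT_measurable => n.
rewrite preimage_bigcup; apply: bigcup_measurable => k _.
rewrite -[X in measurable X]setTI.
rewrite (_ : _ @^-1` _ = (fun t => `|s n - (f t : H)|) @^-1` `]-oo, k.+1%:R^-1[).
  by apply: mf.
by apply/seteqP; split => t /=; rewrite in_itv.
Qed.

Lemma measurable_support (Pi : probability (borel H) R) :
  measurable (topological_support Pi : set (borel H)).
Proof.
rewrite -[X in measurable X]setCK; apply: measurableC.
apply: measurable_open; rewrite openE => f /existsNP[U].
move=> /not_implyP[oU /not_implyP[Uf PU]].
apply: (filterS _ (open_nbhs_nbhs (conj oU Uf))) => g Ug /(_ _ oU Ug).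
exact: PU.
Qed.

(** The complement of the support is covered by the null balls among countably
    many. *)
Lemma support_full (Pi : probability (borel H) R) :
  Pi (~` topological_support Pi) = 0%E.
Proof.
have [s sE] := open_bigcup_balls.
pose V n k := [set y : H | `|s n - y| < k.+1%:R^-1].
have mV n k : measurable (V n k : set (borel H)).
  apply: measurable_open.
  rewrite (_ : V n k = ball (s n) k.+1%:R^-1); first exact: ball_open.
  by rewrite -ball_normE.
apply: measure_negligible.
  by apply: measurableC; exact: measurable_support.
apply: (@negligibleS _ (borel H) _ Pi
  (\bigcup_n \bigcup_k (if Pi (V n k) == 0%E then V n k else set0))).
  move=> f /existsNP[U /not_implyP[oU /not_implyP[Uf PU]]].
  have := Uf; rewrite (sE U oU) => -[n _ [k kU Vf]].
  exists n => //; exists k => //; rewrite ifT//.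
  have PU0 : Pi U = 0%E.
    by apply/eqP; rewrite eq_le measure_ge0 andbT leNgt; apply/negP.
  rewrite -measure_le0 -PU0; apply: le_measure => //; rewrite inE.
    exact: mV.
  exact: measurable_open.
apply: negligible_bigcup => n; apply: negligible_bigcup => k.
case: ifPn => [/eqP V0|_]; last exact: negligible_set0.
by apply/negligibleP; [exact: mV|exact: V0].
Qed.

End BorelSeparable.

(** * Integrals of non-measurable functions *)

Section IntegralFullSet.
Context {R : realType} d (T : measurableType d) (mu : {measure set T -> \bar R}).
Local Open Scope ereal_scope.
Import HBNNSimple.

(** The integral of a nonnegative function is a supremum of integrals of simple
    functions, and multiplying one of these by the indicator of F does not
    change its integral. So the identity extends to non-measurable f. *)
Lemma ge0_integral_full_set (D F : set T) (f : T -> \bar R) :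
  measurable F -> mu (~` F) = 0 -> (forall x, 0 <= f x) ->
  \int[mu]_(x in D) f x = \int[mu]_(x in D `&` F) f x.
Proof.
move=> mF muF f0.
rewrite !ge0_integralE//; apply/eqP; rewrite eq_le; apply/andP; split.
  apply: ge_ereal_sup => _ [h /= hf <-].
  pose g := proj_nnsfun h mF.
  have gE x : g x = (h \_ F) x by rewrite mrestrict.
  apply: ereal_sup_ubound; exists g => /=.
    move=> x; rewrite [X in X%:E](gE x) /patch in_setI.
    by have := hf x; rewrite /patch; case: (x \in F); rewrite ?andbT ?andbF//; case: ifP.
  rewrite (eq_sintegral _ _ gE) -integral_nnsfun// -integralT_nnsfun.
  rewrite [RHS](ge0_negligible_integral (N := ~` F))//=; last 3 first.
  - exact: measurableC.
  - by apply/measurable_EFinP.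
  - by move=> x _; rewrite lee_fin.
  by rewrite setTD setCK.
apply: ge_ereal_sup => _ [h /= hf <-]; apply: ereal_sup_ubound; exists h => //= x.
apply: le_trans (hf x) _; rewrite /patch in_setI.
by case: (x \in D) => //=; case: (x \in F) => //=.
Qed.

End IntegralFullSet.

(** * Gaussian densities tilted by a quadratic exponential *)

Section GaussianIntegrals.
Context {R : realType}.
Local Notation leb := (@lebesgue_measure R).

Lemma normal_peak_gt0E (s : R) : 0 < s ->
  normal_peak s = s^-1 * (Num.sqrt (pi *+ 2))^-1.
Proof.
move=> s0; rewrite /normal_peak -mulrnAr sqrtrM ?sqr_ge0//.
by rewrite sqrtr_sqr gtr0_norm// invfM.
Qed.

Lemma scaled_density_normal (t : R) : 0 < t ->
  scaled_density (normal_pdf 0 1) t = normal_pdf 0 t.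
Proof.
move=> t0; apply/funext => y.
rewrite /scaled_density !normal_pdfE ?oner_eq0 ?gt_eqF// !normal_peak_gt0E//.
rewrite /normal_fun !subr0 invr1 mul1r mulrA; congr (_ * _).
by congr expR; field; rewrite gt_eqF.
Qed.

(** Mean, standard deviation and total mass of the measure with density
    exp (B y - A y^2 / 2) with respect to the centred normal law of standard
    deviation t. *)
Definition tilt_mean (t A B : R) := B * t ^+ 2 / (1 + A * t ^+ 2).
Definition tilt_sd (t A : R) := t / Num.sqrt (1 + A * t ^+ 2).
Definition tilt_mass (t A B : R) :=
  (Num.sqrt (1 + A * t ^+ 2))^-1 * expR (B ^+ 2 * t ^+ 2 / (1 + A * t ^+ 2) / 2).

(** Completing the square. *)
Lemma tilted_normal_pdf (t A B y : R) : 0 < t -> 0 <= A ->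
  expR (B * y - A * y ^+ 2 / 2) * normal_pdf 0 t y =
  tilt_mass t A B * normal_pdf (tilt_mean t A B) (tilt_sd t A) y.
Proof.
move=> t0 A0; have a0 : 0 < 1 + A * t ^+ 2.
  by rewrite ltr_pwDl// mulr_ge0// sqr_ge0.
have s0 : 0 < tilt_sd t A by rewrite divr_gt0// sqrtr_gt0.
rewrite !normal_pdfE ?gt_eqF// /tilt_mass.
have -> : normal_peak (tilt_sd t A) = Num.sqrt (1 + A * t ^+ 2) * normal_peak t.
  by rewrite !normal_peak_gt0E// /tilt_sd invfM invrK; ring.
set r := Num.sqrt (1 + A * t ^+ 2).
have r0 : r != 0 by rewrite gt_eqF// sqrtr_gt0.
rewrite /normal_fun subr0.
rewrite (_ : expR _ * _ = normal_peak t *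
  (expR (B * y - A * y ^+ 2 / 2) * expR (- y ^+ 2 / (t ^+ 2 *+ 2)))); last by ring.
rewrite (_ : r^-1 * _ * _ = normal_peak t *
  (expR (B ^+ 2 * t ^+ 2 / (1 + A * t ^+ 2) / 2) *
   expR (- (y - tilt_mean t A B) ^+ 2 / (tilt_sd t A ^+ 2 *+ 2)))); last by field.
congr (_ * _); rewrite -!expRD; congr expR.
have -> : tilt_sd t A ^+ 2 = t ^+ 2 / (1 + A * t ^+ 2).
  by rewrite /tilt_sd expr_div_n sqr_sqrtr// ltW.
rewrite /tilt_mean; field.
by rewrite !gt_eqF.
Qed.

Lemma measurable_tilt (A B : R) :
  measurable_fun [set: R] (fun y : R => expR (B * y - A * y ^+ 2 / 2)).
Proof.
apply: measurableT_comp => //; apply: measurable_funB; first exact: measurable_funM.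
by apply: measurable_funM => //; apply: measurable_funM => //; exact: measurable_funX.
Qed.

Lemma measurable_sqr_dist (c : R) :
  measurable_fun [set: R] (fun y : R => (y - c) ^+ 2).
Proof. by apply: measurable_funX; exact: measurable_funB. Qed.

Lemma tilt_mass_gt0 (t A B : R) : 0 <= A -> 0 < tilt_mass t A B.
Proof.
move=> A0; rewrite mulr_gt0 ?expR_gt0// invr_gt0 sqrtr_gt0.
by rewrite ltr_pwDl// mulr_ge0// sqr_ge0.
Qed.

Lemma integral_tilted_normal_pdf (t A B : R) : 0 < t -> 0 <= A ->
  (\int[leb]_y (expR (B * y - A * y ^+ 2 / 2) * normal_pdf 0 t y)%:E =
   (tilt_mass t A B)%:E)%E.
Proof.
move=> t0 A0.
under eq_integral do rewrite tilted_normal_pdf// EFinM.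
rewrite ge0_integralZl//.
- by rewrite integral_normal_pdf mule1.
- by apply/measurable_EFinP; exact: measurable_normal_pdf.
- by move=> y _; rewrite lee_fin normal_pdf_ge0.
- by rewrite lee_fin ltW// tilt_mass_gt0.
Qed.

(** Since v <= e^v, the factor y^2 costs no more than doubling the variance, so
    that a second moment is controlled by the mass of a wider Gaussian. *)
Lemma sqr_normal_pdf_le (m s y : R) : 0 < s ->
  (y - m) ^+ 2 * normal_pdf m s y <=
  6 * s ^+ 2 * normal_pdf m (Num.sqrt 2 * s) y.
Proof.
move=> s0; have r0 : 0 < Num.sqrt 2 :> R by rewrite sqrtr_gt0.
have rs0 : 0 < Num.sqrt 2 * s by rewrite mulr_gt0.
rewrite !normal_pdfE ?gt_eqF// !normal_peak_gt0E//.
set p := (Num.sqrt (pi *+ 2))^-1; set v := (y - m) ^+ 2 / (4 * s ^+ 2).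
have p0 : 0 <= p by rewrite invr_ge0.
have -> : normal_fun m (Num.sqrt 2 * s) y = expR (- v).
  rewrite /normal_fun exprMn sqr_sqrtr// /v; congr expR; field.
  by rewrite gt_eqF.
have -> : normal_fun m s y = expR (- v) * expR (- v).
  rewrite /normal_fun -expRD /v; congr expR; field.
  by rewrite gt_eqF.
have -> : (y - m) ^+ 2 = 4 * s ^+ 2 * v by rewrite /v; field; rewrite gt_eqF.
have ve : v * expR (- v) <= 1.
  rewrite expRN ler_pdivrMr ?expR_gt0// mul1r.
  by rewrite (le_trans _ (expR_ge1Dx v))// lerDr.
have r2 : 4 <= 6 * (Num.sqrt 2)^-1 :> R.
  rewrite ler_pdivlMr// -(ler_pXn2r (n := 2)) ?nnegrE ?mulr_ge0 ?(ltW r0)//.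
  by rewrite exprMn sqr_sqrtr//; lra.
rewrite invfM.
rewrite (_ : _ * v * _ = (4 * (v * expR (- v))) * (s ^+ 2 * (s^-1 * p * expR (- v)))); last by ring.
rewrite [leRHS](_ : _ = (6 * (Num.sqrt 2)^-1) * (s ^+ 2 * (s^-1 * p * expR (- v)))); last by ring.
apply: ler_wpM2r.
  by rewrite !mulr_ge0 ?sqr_ge0 ?invr_ge0 ?expR_ge0// ltW.
by apply: le_trans r2; rewrite ler_piMr.
Qed.

Lemma integral_sqr_tilted_normal_pdf (t A B c : R) : 0 < t -> 0 <= A ->
  (\int[leb]_y ((y - c) ^+ 2 * expR (B * y - A * y ^+ 2 / 2) *
                 normal_pdf 0 t y)%:E <=
   (tilt_mass t A B *
    (12 * tilt_sd t A ^+ 2 + 2 * (tilt_mean t A B - c) ^+ 2))%:E)%E.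
Proof.
move=> t0 A0; set m := tilt_mean t A B; set s := tilt_sd t A.
have s0 : 0 < s.
  by rewrite divr_gt0// sqrtr_gt0 ltr_pwDl// mulr_ge0// sqr_ge0.
have Z0 : 0 <= tilt_mass t A B by rewrite ltW// tilt_mass_gt0.
pose u : R := 12 * s ^+ 2; pose v : R := 2 * (m - c) ^+ 2.
have u0 : 0 <= u by rewrite mulr_ge0// sqr_ge0.
have v0 : 0 <= v by rewrite mulr_ge0// sqr_ge0.
pose w := Num.sqrt 2 * s.
have mpdf m' s' : measurable_fun [set: R] (fun y : R => (normal_pdf m' s' y)%:E).
  by apply/measurable_EFinP; exact: measurable_normal_pdf.
have msum : measurable_fun [set: R] (fun y : R =>
    (u%:E * (normal_pdf m w y)%:E + v%:E * (normal_pdf m s y)%:E)%E).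
  by apply: emeasurable_funD; exact: measurable_funeM.
apply: (@le_trans _ _ (\int[leb]_y ((tilt_mass t A B)%:E *
   (u%:E * (normal_pdf m w y)%:E + v%:E * (normal_pdf m s y)%:E)))%E).
  apply: ge0_le_integral => //.
  - move=> y _; rewrite lee_fin mulr_ge0 ?normal_pdf_ge0// mulr_ge0 ?expR_ge0//.
    exact: sqr_ge0.
  - apply/measurable_EFinP; apply: measurable_funM.
      by apply: measurable_funM; [exact: measurable_sqr_dist|exact: measurable_tilt].
    exact: measurable_normal_pdf.
  - exact: (measurable_funeM (tilt_mass t A B)%:E msum).
  - move=> y _; rewrite -!EFinM lee_fin -mulrA tilted_normal_pdf//.
    rewrite -/m -/s mulrCA ler_wpM2l//.
    have := sqr_normal_pdf_le m y s0; have := normal_pdf_ge0 m s y.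
    rewrite -/w /u /v; set g := normal_pdf m s y; set g2 := normal_pdf m w y.
    move=> g0 H.
    have : (y - c) ^+ 2 <= 2 * (y - m) ^+ 2 + 2 * (m - c) ^+ 2.
      by have := sqr_ge0 ((y - m) - (m - c)); nra.
    move=> /(ler_wpM2r g0) /le_trans; apply.
    by rewrite mulrDl; nra.
rewrite ge0_integralZl//; last first.
  by move=> y _; rewrite adde_ge0 ?mule_ge0 ?lee_fin ?normal_pdf_ge0.
rewrite ge0_integralD//; last 4 first.
- by move=> y _; rewrite mule_ge0 ?lee_fin ?normal_pdf_ge0.
- exact: (measurable_funeM u%:E (mpdf m w)).
- by move=> y _; rewrite mule_ge0 ?lee_fin ?normal_pdf_ge0.
- exact: (measurable_funeM v%:E (mpdf m s)).
have pdf_ge0 s' (y : R) : [set: R] y -> (0 <= (normal_pdf m s' y)%:E)%E.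
  by rewrite lee_fin normal_pdf_ge0.
have intZ (k s' : R) : 0 <= k ->
    (\int[leb]_y (k%:E * (normal_pdf m s' y)%:E) = k%:E)%E.
  move=> k0; rewrite ge0_integralZl ?integral_normal_pdf ?mule1//.
    exact: (mpdf m s').
  exact: pdf_ge0.
by rewrite !intZ.
Qed.

End GaussianIntegrals.

Section TiltBounds.
Context {R : realType}.
Variables (n : nat) (rho t c xi : R).
Hypothesis n0 : (0 < n)%N.
Let a := n%:R * rho ^+ 2 * t ^+ 2.
Let V := n%:R * rho ^+ 2.
Let Y := rho * c + (Num.sqrt n%:R)^-1 * xi.
Let B := n%:R * rho * Y.

Let a0 : 0 <= a.
Proof. by rewrite mulr_ge0 ?sqr_ge0// mulr_ge0 ?sqr_ge0. Qed.

Let a1 : 0 < 1 + a. Proof. by rewrite ltr_pwDl. Qed.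

Let s := Num.sqrt (n%:R : R).
Let s0 : 0 < s. Proof. by rewrite sqrtr_gt0 ltr0n. Qed.
Let ss : n%:R = s ^+ 2. Proof. by rewrite sqr_sqrtr. Qed.

(** With B = n rho Y, where Y = rho c + xi / sqrt n is the datum, the posterior
    mean errs by (sqrt n rho t^2 xi - c) / (1 + a): shrinkage costs c / (1 + a),
    and the noise is damped because n rho^2 t^4 = a t^2. *)
Lemma tilt_risk_le :
  12 * tilt_sd t V ^+ 2 + 2 * (tilt_mean t V B - c) ^+ 2 <=
  12 * ((t ^+ 2 + c ^+ 2) / (1 + a)) * (1 + xi ^+ 2).
Proof.
have -> : tilt_sd t V ^+ 2 = t ^+ 2 / (1 + a).
  by rewrite /tilt_sd expr_div_n sqr_sqrtr// ltW.
have -> : tilt_mean t V B - c = (s * rho * t ^+ 2 * xi - c) / (1 + a).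
  rewrite /tilt_mean /V /B /Y -/s /a ss; field.
  by rewrite !gt_eqF// ltr_pwDl// sqr_ge0.
set i := (1 + a)^-1; have i0 : 0 < i by rewrite invr_gt0.
have i1 : i <= 1 by rewrite invf_le1// lerDl.
have ai : a * i <= 1 by rewrite ler_pdivrMr// mul1r lerDr.
pose p := t ^+ 2; pose X := xi ^+ 2; pose K := c ^+ 2.
have E : (s * rho * p * xi - c) ^+ 2 <= 2 * (a * p * X) + 2 * K.
  have -> : a * p * X = (s * rho * p * xi) ^+ 2 by rewrite /a ss /p /X; ring.
  by have := sqr_ge0 (s * rho * p * xi + c); rewrite /K; nra.
have p0 : 0 <= p by exact: sqr_ge0.
have X0 : 0 <= X by exact: sqr_ge0.
have K0 : 0 <= K by exact: sqr_ge0.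
have E2 : (s * rho * p * xi - c) ^+ 2 * i ^+ 2 <= 2 * (p * X * i) + 2 * (K * i).
  apply: (le_trans (ler_wpM2r (sqr_ge0 i) E)).
  rewrite mulrDl lerD//.
    rewrite (_ : _ * i ^+ 2 = 2 * (p * X * i) * (a * i)); last by ring.
    rewrite ler_piMr//; apply: mulr_ge0 => //.
    by apply: mulr_ge0; [exact: mulr_ge0|exact: ltW].
  rewrite (_ : _ * i ^+ 2 = 2 * (K * i) * i); last by ring.
  by rewrite ler_piMr//; apply: mulr_ge0 => //; apply: mulr_ge0 => //; exact: ltW.
rewrite exprMn -/p -/X -/K.
have : 0 <= p * i by rewrite mulr_ge0// ltW.
have : 0 <= K * i by rewrite mulr_ge0// ltW.
move: E2; move: (_ ^+ 2 * i ^+ 2) => q E2 Ki pi.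
have : 0 <= K * i * X by rewrite mulr_ge0.
have : 0 <= p * i * X by rewrite mulr_ge0.
by nra.
Qed.

(** The exponent of the mass is a / (1 + a) times n Y^2 / 2. For a >= 1 the first
    factor is at least 1/2, and n Y^2 >= n rho^2 c^2 / 2 - xi^2. *)
Lemma tilt_mass_ge (lam G : R) : 1 <= a -> (1 + a) <= expR (2 * lam) ->
  G <= n%:R * rho ^+ 2 ->
  expR (- lam + G * c ^+ 2 / 8 - xi ^+ 2 / 4) <= tilt_mass t V B.
Proof.
move=> a_ge1 alam Gn; rewrite /tilt_mass -/a.
have lamE : expR (- lam) <= (Num.sqrt (1 + a))^-1.
  rewrite expRN lef_pV2 ?posrE ?expR_gt0 ?sqrtr_gt0//.
  rewrite -[leRHS]ger0_norm ?expR_ge0// -sqrtr_sqr ler_wsqrtr//.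
  by rewrite -expRM_natl.
rewrite -addrA expRD ler_pM ?expR_ge0// ler_expR.
pose Q := (s * rho * c + xi) ^+ 2.
have -> : B ^+ 2 * t ^+ 2 / (1 + a) / 2 = a / (1 + a) * (Q / 2).
  rewrite /B /Y -/s /a /Q ss; field.
  by rewrite !gt_eqF// ltr_pwDl// sqr_ge0.
have Q0 : 0 <= Q by exact: sqr_ge0.
have half : 1 / 2 <= a / (1 + a) by rewrite ler_pdivlMr//; lra.
have QE : n%:R * rho ^+ 2 * c ^+ 2 / 2 - xi ^+ 2 <= Q.
  by have := sqr_ge0 (s * rho * c + 2 * xi); rewrite /Q ss; nra.
have GE : G * c ^+ 2 <= n%:R * rho ^+ 2 * c ^+ 2 by apply: ler_wpM2r => //; exact: sqr_ge0.
apply: (@le_trans _ _ (1 / 2 * (Q / 2))); first lra.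
by apply: ler_wpM2r => //; rewrite divr_ge0.
Qed.

End TiltBounds.

Lemma prod_mass_ge {R : realType} (Z c xi : nat -> R) (lam G X theta : R) m j :
  0 <= lam -> 0 <= G ->
  (forall k, (k < j)%N ->
     expR (- lam + G * c k ^+ 2 / 8 - xi k ^+ 2 / 4) <= Z k) ->
  theta <= \sum_(m <= k < j) c k ^+ 2 -> \sum_(k < j) xi k ^+ 2 <= X ->
  expR (- (j%:R * lam) + G * theta / 8 - X / 4) <= \prod_(m <= k < j) Z k.
Proof.
move=> lam0 G0 Zj thetaj Xj.
apply: (@le_trans _ _ (\prod_(m <= k < j)
    expR (- lam + G * c k ^+ 2 / 8 - xi k ^+ 2 / 4))); last first.
  rewrite big_nat_cond [leRHS]big_nat_cond; apply: ler_prod => k.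
  by rewrite andbT => /andP[_ kj]; rewrite expR_ge0 Zj.
rewrite -expR_sum ler_expR sumrB big_split/=.
have -> : \sum_(m <= k < j) - lam = - ((j - m)%N%:R * lam).
  by rewrite big_const_nat iter_addr addr0 mulNrn mulr_natl.
have -> : \sum_(m <= k < j) G * c k ^+ 2 / 8 = G * (\sum_(m <= k < j) c k ^+ 2) / 8.
  by rewrite mulr_sumr mulr_suml.
have -> : \sum_(m <= k < j) xi k ^+ 2 / 4 = (\sum_(m <= k < j) xi k ^+ 2) / 4.
  by rewrite mulr_suml.
have jm : (j - m)%N%:R * lam <= j%:R * lam by rewrite ler_wpM2r// ler_nat leq_subr.
have Gt : G * theta <= G * (\sum_(m <= k < j) c k ^+ 2) by rewrite ler_wpM2l.
have Xm : \sum_(m <= k < j) xi k ^+ 2 <= X.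
  apply: le_trans Xj; have [jm'|mj] := leqP j m.
    by rewrite big_geq//; apply: sumr_ge0 => k _; exact: sqr_ge0.
  rewrite -(big_mkord xpredT (fun k => xi k ^+ 2)).
  rewrite (big_cat_nat (n := m) (leq0n m) (ltnW mj))/= lerDr.
  by apply: sumr_ge0 => k _; exact: sqr_ge0.
lra.
Qed.

(** * The likelihood as a function on the Hilbert space *)

Section Likelihood.
Context {R : realType} {H1 H2 : completeNormedModType R}.
Variables (ip1 : {dot H1 for idfun}) (ip2 : {dot H2 for idfun}).
Hypotheses (ip1_norm : induces_norm ip1) (ip2_norm : induces_norm ip2).
Variables (A : {linear H1 -> H2}) (A_cont : continuous A).
Variables (e : nat -> H1) (rho : nat -> R).
Hypothesis e_orth : forall j k, ip1 (e j) (e k) = (j == k)%:R.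
Hypothesis Ae_orth : forall j k,
  ip2 (A (e j)) (A (e k)) = rho k ^+ 2 * (j == k)%:R.

Lemma sqr_norm_A_comb m (x : nat -> R) :
  `|A (\sum_(i < m) x i *: e i)| ^+ 2 = \sum_(k < m) rho k ^+ 2 * x k ^+ 2.
Proof.
rewrite ip2_norm linear_sum dot_suml; apply: eq_bigr => i _.
rewrite linearZ/= dotZl dot_sumr (bigD1 i)//= big1 => [|j ji].
  by rewrite linearZ/= dotZr Ae_orth eqxx mulr1 addr0; ring.
rewrite linearZ/= dotZr Ae_orth (_ : (i == j :> nat) = false) ?mulr0//.
by apply/negbTE; rewrite eq_sym.
Qed.

Definition finitely_supported : set H1 :=
  [set f | exists N, forall k, (N <= k)%N -> ip1 f (e k) = 0].

Lemma finitely_supported_comb m (x : nat -> R) :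
  finitely_supported (\sum_(i < m) x i *: e i).
Proof. by exists m => k mk; rewrite dot_basis_comb// ltnNge mk. Qed.

Lemma measurable_finitely_supported :
  measurable (finitely_supported : set (borel H1)).
Proof.
rewrite (_ : finitely_supported = \bigcup_N \bigcap_(k in [set k | (N <= k)%N])
    ((fun f : borel H1 => ip1 f (e k)) @^-1` [set 0])); last first.
  by apply/seteqP; split => [f [N fN]|f [N _ fN]]; exists N.
apply: bigcupT_measurable => N; apply: bigcap_measurableType => k _.
rewrite -[X in measurable X]setTI.
exact: (continuous_measurable_borel (continuous_dot ip1_norm (y := e k))).
Qed.

Lemma finitely_supported_sum_eq (f : H1) N (u : nat -> R) n :
  (forall k, (N <= k)%N -> ip1 f (e k) = 0) -> (N <= n)%N ->
  \sum_(k < n) rho k * ip1 f (e k) * u k = \sum_(k < N) rho k * ip1 f (e k) * u k.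
Proof.
move=> fN Nn; rewrite -!(big_mkord xpredT (fun k => rho k * ip1 f (e k) * u k)).
rewrite (big_cat_nat (n := N))//= [X in _ + X]big_nat_cond [X in _ + X]big1 ?addr0//.
by move=> k /andP[/andP[Nk _] _]; rewrite fN// mulr0 mul0r.
Qed.

Lemma finitely_supported_cvg (f : H1) N (u : nat -> R) :
  (forall k, (N <= k)%N -> ip1 f (e k) = 0) ->
  (fun n => \sum_(k < n) rho k * ip1 f (e k) * u k) @ \oo -->
  \sum_(k < N) rho k * ip1 f (e k) * u k.
Proof.
move=> fN; apply: cvg_near_cst; exists N => // n /= Nn.
exact: finitely_supported_sum_eq.
Qed.

(** The coordinates separate because A maps the basis to an orthogonal
    system. *)
Lemma likelihood_comb n (Y : nat -> R) m (x : nat -> R) :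
  likelihood ip1 e rho A n Y (\sum_(i < m) x i *: e i) =
  \prod_(k < m) expR (n%:R * rho k * Y k * x k - n%:R * rho k ^+ 2 * x k ^+ 2 / 2).
Proof.
rewrite /likelihood sqr_norm_A_comb -expR_sum; congr expR.
have fm k : (m <= k)%N -> ip1 (\sum_(i < m) x i *: e i) (e k) = 0.
  by move=> mk; rewrite dot_basis_comb// ltnNge mk.
rewrite (cvg_lim _ (finitely_supported_cvg (u := Y) fm))//.
rewrite !mulr_sumr -sumrB; apply: eq_bigr => k _.
by rewrite dot_basis_comb// ltn_ord; field.
Qed.

Lemma likelihood_ge0 n Y f : 0 <= likelihood ip1 e rho A n Y f.
Proof. exact: expR_ge0. Qed.

(** For finitely supported parameters the series converges, so that the
    likelihood is a pointwise limit of measurable functions. *)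
Lemma measurable_likelihood d (T : measurableType d) (D : set T) n
    (Y : nat -> T -> R) (f : T -> borel H1) :
  (forall k, measurable_fun setT (Y k)) -> measurable_fun setT f ->
  (forall t, D t -> finitely_supported (f t)) ->
  measurable_fun D (fun t => likelihood ip1 e rho A n (Y^~ t) (f t)).
Proof.
move=> mY mf Df; apply: measurableT_comp => //; apply: measurable_funB.
  apply: measurable_funM => //.
  apply: (@measurable_fun_cvg _ _ _ D
    (fun N t => \sum_(k < N) rho k * ip1 (f t) (e k) * Y k t)).
    move=> N; apply: measurable_funTS; apply: measurable_sum => k.
    apply: measurable_funM; last exact: mY.
    apply: measurable_funM => //.
    exact: (measurableT_comp (continuous_measurable_borel
      (continuous_dot ip1_norm (y := e k))) mf).
  move=> t /Df[N fN]; have := finitely_supported_cvg (u := Y^~ t) fN.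
  by move=> /[dup] /cvg_lim <-.
apply: measurable_funTS; apply: measurable_funM => //.
apply: measurable_funX.
apply: (measurableT_comp (f := fun f : borel H1 => `|A f|) _ mf).
apply: continuous_measurable_borel => x.
by apply: (continuous_comp (A_cont (x := x))); exact: norm_continuous.
Qed.

Variable Pi : probability (borel H1) R.
Hypothesis Pi_fin : Pi (~` finitely_supported) = 0%E.

Lemma integral_likelihood_fin n Y (D : set H1) :
  (\int[Pi]_(f in D) (likelihood ip1 e rho A n Y f)%:E =
   \int[Pi]_(f in D `&` finitely_supported)
     (likelihood ip1 e rho A n Y f)%:E)%E.
Proof.
apply: ge0_integral_full_set => //; first exact: measurable_finitely_supported.
by move=> f; rewrite lee_fin likelihood_ge0.
Qed.

(** Tonelli's theorem applies once the parameter is restricted to the finitely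
    supported ones, on which the likelihood is jointly measurable. *)
Lemma measurable_integral_likelihood d (T : measurableType d) n
    (Y : nat -> T -> R) (D : set H1) :
  (forall k, measurable_fun setT (Y k)) -> measurable (D : set (borel H1)) ->
  measurable_fun setT (fun t =>
    \int[Pi]_(f in D) (likelihood ip1 e rho A n (Y^~ t) f)%:E)%E.
Proof.
move=> mY mD.
pose E : set (T * borel H1) := setT `*` (D `&` finitely_supported).
pose G := (fun tf : T * borel H1 =>
  (likelihood ip1 e rho A n (Y^~ tf.1) tf.2)%:E) \_ E.
have mDF : measurable (D `&` finitely_supported : set (borel H1)).
  by apply: measurableI => //; exact: measurable_finitely_supported.
have mE : measurable E by exact: measurableX.
have mG : measurable_fun setT G.
  apply/(measurable_restrictT _ mE)/measurable_EFinP.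
  apply: (@measurable_likelihood _ _ E n (fun k tf => Y k tf.1) snd).
  - by move=> k; exact: measurableT_comp.
  - exact: measurable_snd.
  - by move=> [t f] [_ []].
rewrite (_ : (fun t => _) = (fun t => \int[Pi]_f G (t, f))%E); last first.
  apply/funext => t; rewrite integral_likelihood_fin integral_mkcond.
  by apply: eq_integral => f _; rewrite /G /patch /E in_setX/= in_setT.
apply: measurable_fun_fubini_tonelli_F => //.
by move=> tf; rewrite /G; apply: erestrict_ge0 => ? _; rewrite lee_fin likelihood_ge0.
Qed.

End Likelihood.

(** * Posterior integrals under a sieve prior *)

Lemma measurable_fun_select d (T : measurableType d) d' (T' : measurableType d')
    (M : T -> nat) (F : nat -> T -> T') :
  measurable_fun setT M -> (forall m, measurable_fun setT (F m)) ->
  measurable_fun setT (fun t => F (M t) t).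
Proof.
move=> mM mF _ B mB; rewrite setTI.
rewrite (_ : _ @^-1` _ = \bigcup_m (M @^-1` [set m] `&` F m @^-1` B)).
  apply: bigcupT_measurable => m; apply: measurableI; rewrite -[X in measurable X]setTI.
    exact: mM.
  exact: mF.
by apply/seteqP; split => [t Bt|t [m _ [/= <-]]//]; exists (M t).
Qed.

Section Sieve.
Context {R : realType} {H1 H2 : completeNormedModType R}.
Variables (ip1 : {dot H1 for idfun}) (ip2 : {dot H2 for idfun}).
Hypotheses (ip1_norm : induces_norm ip1) (ip2_norm : induces_norm ip2).
Hypothesis H1_separable : separable_space H1.
Variables (A : {linear H1 -> H2}) (A_cont : continuous A).
Variables (e : nat -> H1) (rho : nat -> R).
Hypothesis e_orth : forall j k, ip1 (e j) (e k) = (j == k)%:R.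
Hypothesis Ae_orth : forall j k,
  ip2 (A (e j)) (A (e k)) = rho k ^+ 2 * (j == k)%:R.
Variables (h : nat -> R) (tau : nat -> R) (Pi : probability (borel H1) R).
Hypothesis tau0 : forall k, 0 < tau k.
Context d (W : measurableType d) (Q : probability W R) (M : {RV Q >-> nat})
  (x : nat -> {RV Q >-> R}).
Hypothesis M0 : forall w, (0 < M w)%N.
Hypothesis QM : forall m, (0 < m)%N -> Q (M @^-1` [set m]) = (h m)%:E.
Hypothesis Qx : forall (m : nat) (B : nat -> set R), (0 < m)%N ->
  (forall k, measurable (B k)) ->
  Q [set w | M w = m /\ forall k, (k < m)%N -> B k (x k w)] =
  ((h m)%:E * \prod_(k < m)
   \int[lebesgue_measure]_(y in B k)
     (scaled_density (normal_pdf 0 1) (tau k) y)%:E)%E.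
Let draw (w : W) : borel H1 := \sum_(k < M w) x k w *: e k.
Hypothesis PiQ : forall B : set (borel H1), measurable B ->
  Pi B = Q [set w | B (draw w)].

(** By Pythagoras the distance of a draw to a fixed point is a measurable function
    of the level and of finitely many coefficients. *)
Lemma measurable_draw : measurable_fun setT draw.
Proof.
apply: measurable_fun_borel => // c.
apply: (measurable_fun_select
  (F := fun m w => `|c - \sum_(k < m) x k w *: e k|)) => // m.
rewrite (_ : (fun w => _) = (fun w => Num.sqrt
   (\sum_(k < m) (x k w - ip1 c (e k)) ^+ 2 + residual ip1 e c m))); last first.
  apply/funext => w.
  have /= <- := sqr_dist_comb ip1_norm e_orth m (fun k => x k w) c.
  by rewrite sqrtr_sqr normr_id distrC.
apply: measurableT_comp.
  by apply: continuous_measurable_fun; exact: sqrt_continuous.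
apply: measurable_funD => //; apply: measurable_sum => k.
by apply: measurable_funX; exact: measurable_funB.
Qed.

Lemma prior_finitely_supported : Pi (~` finitely_supported ip1 e) = 0%E.
Proof.
rewrite PiQ; last by apply: measurableC; exact: measurable_finitely_supported.
rewrite (_ : [set w | _] = set0) ?measure0//.
apply/seteqP; split => // w; apply.
exact: (finitely_supported_comb e_orth _ (fun k => x k w)).
Qed.

Let level m := M @^-1` [set m].

Lemma measurable_level m : measurable (level m).
Proof. by rewrite -[level m]setTI; exact: measurable_funP. Qed.

Variables (n : nat) (Y : nat -> R).
Let L := likelihood ip1 e rho A n Y.

Lemma measurable_likelihood_draw : measurable_fun setT (fun w => L (draw w)).
Proof.
apply: (@measurable_likelihood _ _ _ _ ip1_norm _ A_cont e rho _ W
  setT n (fun k _ => Y k) draw).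
- by [].
- exact: measurable_draw.
by move=> w _; exact: (finitely_supported_comb e_orth _ (fun k => x k w)).
Qed.

Lemma integral_likelihood_draw (D : set (borel H1)) : measurable D ->
  (\int[Pi]_(f in D) (L f)%:E =
   \sum_(m <oo) \int[Q]_(w in draw @^-1` D `&` level m) (L (draw w))%:E)%E.
Proof.
move=> mD; rewrite integral_likelihood_fin//; last exact: prior_finitely_supported.
set F := finitely_supported ip1 e.
have mF : measurable (F : set (borel H1)) by exact: measurable_finitely_supported.
have mDF : measurable (D `&` F : set (borel H1)) by exact: measurableI.
have mdraw B : measurable B -> measurable (draw @^-1` B).
  by move=> mB; rewrite -[X in measurable X]setTI; exact: measurable_draw.
transitivity (\int[pushforward Q draw]_(f in D `&` F) (L f)%:E)%E.
  by apply: eq_measure_integral => [|? B mB _]; [exact: measurable_draw|exact: PiQ].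
rewrite ge0_integral_pushforward//; last 3 first.
- exact: measurable_draw.
- apply/measurable_EFinP.
  apply: (@measurable_likelihood _ _ _ _ ip1_norm _ A_cont e rho _ (borel H1)
     (D `&` F) n (fun k _ => Y k) id) => //.
  by move=> f [].
- by move=> f _; rewrite lee_fin; exact: likelihood_ge0.
rewrite (_ : draw @^-1` (D `&` F) = \bigcup_m (draw @^-1` D `&` level m)); last first.
  apply/seteqP; split => [w [Dw _]|w [m _ [Dw _]]]; first by exists (M w).
  by split=> //; exact: (finitely_supported_comb e_orth _ (fun k => x k w)).
rewrite ge0_integral_bigcup//.
- by move=> m; apply: measurableI; [exact: mdraw|exact: measurable_level].
- by apply: measurable_funTS; apply/measurable_EFinP; exact: measurable_likelihood_draw.
- by move=> w _; rewrite lee_fin; exact: likelihood_ge0.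
- by move=> m m' _ _ [w [[_ <-] [_ <-]]].
Qed.

(* On a level above k the coordinate k enters the likelihood through the factor
   exp (B k y - V k y^2 / 2). Its integral against the prior is Z k, and S c k
   bounds the posterior mean of the squared distance to c. *)
Let B k := n%:R * rho k * Y k.
Let V k := n%:R * rho k ^+ 2.
Let Z k := tilt_mass (tau k) (V k) (B k).

Let V0 k : 0 <= V k. Proof. by rewrite mulr_ge0// sqr_ge0. Qed.

Lemma likelihood_level m w : level m w ->
  L (draw w) = \prod_(k < m) expR (B k * x k w - V k * x k w ^+ 2 / 2).
Proof.
move=> <-; rewrite /L /draw.
by rewrite (likelihood_comb ip2_norm e_orth Ae_orth n Y (M w) (fun k => x k w)).
Qed.

Lemma product_integral_level m (phi : nat -> R -> R) (I : nat -> R) : (0 < m)%N ->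
  (forall k, measurable_fun setT (phi k)) -> (forall k y, 0 <= phi k y) ->
  (forall k, (k < m)%N -> (\int[lebesgue_measure]_y
     (phi k y * normal_pdf 0 (tau k) y)%:E = (I k)%:E)%E) ->
  (\int[Q]_(w in level m) (\prod_(k < m) phi k (x k w))%:E =
   (h m * \prod_(k < m) I k)%:E)%E.
Proof.
move=> m0 mphi phi0 phiI.
apply: (@product_integral _ _ _ Q (level m) x (fun k => normal_pdf 0 (tau k)) m
  (h m)).
- exact: measurable_level.
- by move=> k; exact: measurable_funP.
- by move=> k; exact: measurable_normal_pdf.
- by move=> k y; exact: normal_pdf_ge0.
- by move=> k; exact: integral_normal_pdf.
- by rewrite -lee_fin -QM.
- move=> C mC; rewrite [LHS]Qx//; congr (_ * _)%E; apply: eq_bigr => k _.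
  by apply: eq_integral => y _; rewrite scaled_density_normal.
- exact: mphi.
- exact: phi0.
- exact: phiI.
Qed.

Lemma integral_likelihood_level m : (0 < m)%N ->
  (\int[Q]_(w in level m) (L (draw w))%:E = (h m * \prod_(k < m) Z k)%:E)%E.
Proof.
move=> m0; rewrite -(@product_integral_level m
  (fun k y => expR (B k * y - V k * y ^+ 2 / 2)) Z)//.
- by apply: eq_integral => w /[!inE] mw; rewrite (likelihood_level mw).
- by move=> k; exact: measurable_tilt.
- by move=> k _; exact: integral_tilted_normal_pdf.
Qed.

Let S c k := 12 * tilt_sd (tau k) (V k) ^+ 2 +
  2 * (tilt_mean (tau k) (V k) (B k) - c) ^+ 2.

(** The squared error changes one factor of the product only. *)
Lemma integral_sqr_coord_level m i c : (i < m)%N ->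
  (\int[Q]_(w in level m) ((x i w - c) ^+ 2 * L (draw w))%:E <=
   (S c i * (h m * \prod_(k < m) Z k))%:E)%E.
Proof.
move=> im; have m0 : (0 < m)%N by exact: leq_ltn_trans im.
pose l k y := expR (B k * y - V k * y ^+ 2 / 2).
pose J := (\int[lebesgue_measure]_y ((y - c) ^+ 2 * l i y * normal_pdf 0 (tau i) y)%:E)%E.
have J0 : (0 <= J)%E.
  apply: integral_ge0 => y _.
  by rewrite lee_fin mulr_ge0 ?normal_pdf_ge0// mulr_ge0 ?expR_ge0 ?sqr_ge0.
have JS : (J <= (Z i * S c i)%:E)%E by exact: integral_sqr_tilted_normal_pdf.
have J_fin : J \is a fin_num.
  by rewrite ge0_fin_numE// (le_lt_trans JS)// ltry.
have hm : 0 <= h m by rewrite -lee_fin -QM.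
pose phi k y := if k == i then (y - c) ^+ 2 * l k y else l k y.
pose I k := if k == i then fine J else Z k.
have -> : (\int[Q]_(w in level m) ((x i w - c) ^+ 2 * L (draw w))%:E =
    \int[Q]_(w in level m) (\prod_(k < m) phi k (x k w))%:E)%E.
  apply: eq_integral => w /[!inE] mw; rewrite (likelihood_level mw); congr EFin.
  rewrite (bigD1 (Ordinal im))//= [in RHS](bigD1 (Ordinal im))//= /phi eqxx mulrA.
  congr (_ * _); apply: eq_bigr => k ki.
  by rewrite (_ : (k == i :> nat) = false)//; exact/negbTE.
rewrite (@product_integral_level m phi I)// /phi /I.
- pose P := \prod_(k < m | k != Ordinal im) Z k.
  have ZP : \prod_(k < m) Z k = Z i * P by rewrite (bigD1 (Ordinal im)).
  have IP : \prod_(k < m) (if (k : nat) == i then fine J else Z k) = fine J * P.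
    rewrite (bigD1 (Ordinal im))//= eqxx; congr (_ * _); apply: eq_bigr => k ki.
    by rewrite (_ : (k == i :> nat) = false)//; exact/negbTE.
  rewrite lee_fin IP ZP.
  rewrite [leRHS](_ : _ = Z i * S c i * (h m * P)); last by ring.
  rewrite [leLHS](_ : _ = fine J * (h m * P)); last by ring.
  apply: ler_wpM2r; last by rewrite -lee_fin fineK.
  by rewrite mulr_ge0// prodr_ge0// => k _; rewrite ltW//; exact: tilt_mass_gt0.
- move=> k; case: eqP => _; last exact: measurable_tilt.
  by apply: measurable_funM; [exact: measurable_sqr_dist|exact: measurable_tilt].
- move=> k y; case: eqP => _; rewrite ?expR_ge0//.
  by rewrite mulr_ge0 ?expR_ge0 ?sqr_ge0.
- move=> k _; case: eqP => [->|_]; first by rewrite fineK.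
  exact: integral_tilted_normal_pdf.
Qed.

(** Chebyshev's inequality for the posterior given the truncation level. *)
Lemma integral_likelihood_far_level (f0 : H1) (r : R) m : 0 < r -> (0 < m)%N ->
  (\int[Q]_(w in draw @^-1` [set f : H1 | (r < `|f - f0|)%R] `&` level m)
      (L (draw w))%:E <=
   ((\sum_(k < m) S (ip1 f0 (e k)) k + residual ip1 e f0 m) / r ^+ 2 *
    (h m * \prod_(k < m) Z k))%:E)%E.
Proof.
move=> r0 m0; have rr0 : 0 < r ^+ 2 by rewrite exprn_gt0.
have Lge0 w : 0 <= L (draw w) by exact: likelihood_ge0.
have mL : measurable_fun setT (fun w => L (draw w)).
  exact: measurable_likelihood_draw.
pose c k := ip1 f0 (e k); pose Rm := residual ip1 e f0 m.
have Rm0 : 0 <= Rm by exact: residual_ge0.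
pose D := draw @^-1` [set f : H1 | (r < `|f - f0|)%R] `&` level m.
have mD : measurable D.
  apply: measurableI; last exact: measurable_level.
  rewrite -[X in measurable X]setTI; apply: measurable_draw => //.
  apply: measurable_open; exact: open_far.
have msq k : measurable_fun (level m) (fun w => ((x k w - c k) ^+ 2 * L (draw w))%:E).
  apply/measurable_EFinP/measurable_funTS/measurable_funM => //.
  by apply: measurable_funX; exact: measurable_funB.
have mRL : measurable_fun (level m) (fun w => (Rm * L (draw w))%:E).
  by apply/measurable_EFinP/measurable_funTS/measurable_funM.
pose F w := (\sum_(k < m) ((x k w - c k) ^+ 2 * L (draw w))%:E +
             (Rm * L (draw w))%:E)%E.
have mF : measurable_fun (level m) F.
  by apply: emeasurable_funD => //; apply: emeasurable_sum.
have F0 w : (0 <= F w)%E.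
  rewrite adde_ge0 ?sume_ge0// => [k _|]; rewrite lee_fin mulr_ge0// sqr_ge0//.
have FE w : level m w -> F w = (`|(draw w : H1) - f0| ^+ 2 * L (draw w))%:E.
  move=> mw; rewrite /F sumEFin -EFinD -mulr_suml -mulrDl; congr (_ * _)%:E.
  have /= <- := sqr_dist_comb ip1_norm e_orth m (fun k => x k w) f0.
  by rewrite /draw (mw : M w = m).
apply: (@le_trans _ _ (\int[Q]_(w in D) ((r ^+ 2)^-1%:E * F w))%E).
  apply: ge0_le_integral => //.
  - by move=> w _; rewrite lee_fin.
  - exact/measurable_EFinP/measurable_funTS.
  - apply: measurable_funeM; apply: (measurable_funS (measurable_level m) _ mF).
    exact: subIsetr.
  - move=> w [/= rw mw]; rewrite FE// -EFinM lee_fin mulrA ler_peMl//.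
    rewrite mulrC ler_pdivlMr// mul1r.
    by rewrite lerXn2r ?nnegrE ?normr_ge0// ltW.
apply: (@le_trans _ _ (\int[Q]_(w in level m) ((r ^+ 2)^-1%:E * F w))%E).
  apply: ge0_subset_integral => //; first exact: measurable_level.
  - exact: measurable_funeM.
  - by move=> w _; rewrite mule_ge0// lee_fin invr_ge0 ltW.
  - exact: subIsetr.
have mlev := measurable_level m.
have mSum : measurable_fun (level m)
    (fun w => \sum_(k < m) ((x k w - c k) ^+ 2 * L (draw w))%:E)%E.
  exact: emeasurable_sum.
have sq0 k w : (0 <= ((x k w - c k) ^+ 2 * L (draw w))%:E)%E.
  by rewrite lee_fin mulr_ge0// sqr_ge0.
have Sum0 w : level m w ->
    (0 <= \sum_(k < m) ((x k w - c k) ^+ 2 * L (draw w))%:E)%E.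
  by move=> _; exact: sume_ge0.
have RL0 w : level m w -> (0 <= (Rm * L (draw w))%:E)%E.
  by move=> _; rewrite lee_fin mulr_ge0.
have L0' w : level m w -> (0 <= (L (draw w))%:E)%E by rewrite lee_fin.
have mL' : measurable_fun (level m) (fun w => (L (draw w))%:E).
  exact/measurable_EFinP/measurable_funTS.
rewrite ge0_integralZl//; last by rewrite lee_fin invr_ge0 ltW.
rewrite ge0_integralD// ge0_integral_sum//.
under [X in (_ * (_ + X))%E]eq_integral do rewrite EFinM.
rewrite ge0_integralZl//.
rewrite integral_likelihood_level//; set E := h m * _.
rewrite -/Rm -[X in (X + Rm) / _]/(\sum_(k < m) S (c k) k).
set SS := \sum_(k < m) S (c k) k.
rewrite (_ : (SS + Rm) / r ^+ 2 * E = (r ^+ 2)^-1 * ((SS + Rm) * E)); last by ring.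
rewrite [leRHS]EFinM lee_wpmul2l ?lee_fin ?invr_ge0 ?(ltW rr0)//.
rewrite -EFinM [in leRHS]mulrDl [leRHS]EFinD; apply: leeD2r.
rewrite mulr_suml -sumEFin.
by apply: lee_sum => k _; exact: integral_sqr_coord_level.
Qed.

Hypothesis h0 : forall m, (0 < m)%N -> 0 < h m.

Let evid m := (\int[Q]_(w in level m) (L (draw w))%:E)%E.

Let evid_ge0 m : (0 <= evid m)%E.
Proof. by apply: integral_ge0 => w _; rewrite lee_fin; exact: likelihood_ge0. Qed.

(** The support has full measure, hence the evidence is an integral over the
    whole space and splits along the levels. *)
Lemma evidence_sum :
  (\int[Pi]_(f in topological_support Pi) (L f)%:E = \sum_(m <oo) evid m)%E.
Proof.
rewrite -[topological_support Pi]setTI -ge0_integral_full_set.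
- rewrite integral_likelihood_draw//; apply: eq_eseriesr => m _.
  by rewrite preimage_setT setTI.
- exact: measurable_support.
- exact: support_full.
- by move=> f; rewrite lee_fin; exact: likelihood_ge0.
Qed.

Lemma evidence_ge_level m : (evid m <=
  \int[Pi]_(f in topological_support Pi) (L f)%:E)%E.
Proof.
rewrite evidence_sum; apply: le_trans (nneseries_lim_ge m.+1 (fun n _ _ => evid_ge0 n)).
by rewrite big_nat_recr//= leeDr// sume_ge0.
Qed.

Lemma evidence_gt0 : (0 < \int[Pi]_(f in topological_support Pi) (L f)%:E)%E.
Proof.
apply: lt_le_trans (evidence_ge_level 1).
rewrite /evid integral_likelihood_level// lte_fin mulr_gt0 ?h0// prodr_gt0// => k _.
exact: tilt_mass_gt0.
Qed.

(** Levels with a small bias are treated by Chebyshev's inequality, the others,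
    all below j, by comparing their mass with that of the level j. *)
Lemma integral_likelihood_far (f0 : H1) (r v theta u : R) (j : nat) :
  0 < r -> (0 < j)%N -> 0 <= theta -> 0 <= u ->
  (forall m, \sum_(k < m) S (ip1 f0 (e k)) k <= v) ->
  (forall m, (0 < m < j)%N -> residual ip1 e f0 j + theta < residual ip1 e f0 m ->
     h m * \prod_(k < m) Z k <= u * (h j * \prod_(k < j) Z k)) ->
  (\int[Pi]_(f in [set f : H1 | (r < `|f - f0|)%R]) (L f)%:E <=
   ((v + residual ip1 e f0 j + theta) / r ^+ 2 + j%:R * u)%:E *
   \int[Pi]_(f in topological_support Pi) (L f)%:E)%E.
Proof.
move=> r0 j0 theta0 u0 Sv mj.
have u0' : (0 <= u%:E)%E by rewrite lee_fin.
have rr0 : 0 < r ^+ 2 by rewrite exprn_gt0.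
have Rj0 : 0 <= residual ip1 e f0 j by exact: residual_ge0.
have v0 : 0 <= v by have := Sv 0; rewrite big_ord0.
have mL : measurable_fun setT (fun w => L (draw w)) by exact: measurable_likelihood_draw.
set kappa := (v + residual ip1 e f0 j + theta) / r ^+ 2.
have kappa0 : 0 <= kappa by rewrite divr_ge0 ?(ltW rr0)// 2?addr_ge0.
have kappa0' : (0 <= kappa%:E)%E by rewrite lee_fin.
pose D := [set f : H1 | (r < `|f - f0|)%R].
have mD : measurable (D : set (borel H1)).
  apply: measurable_open; exact: open_far.
rewrite integral_likelihood_draw// evidence_sum.
set far := fun m => (\int[Q]_(w in draw @^-1` D `&` level m) (L (draw w))%:E)%E.
have far0 m : (0 <= far m)%E.
  by apply: integral_ge0 => w _; rewrite lee_fin; exact: likelihood_ge0.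
have mdD m : measurable (draw @^-1` D `&` level m).
  apply: measurableI; last exact: measurable_level.
  by rewrite -[X in measurable X]setTI; exact: measurable_draw.
have far_evid m : (far m <= evid m)%E.
  apply: ge0_subset_integral => //.
  - exact: measurable_level.
  - exact/measurable_EFinP/measurable_funTS.
  - by move=> w _; rewrite lee_fin; exact: likelihood_ge0.
have far_level0 : far 0 = 0%E.
  rewrite /far (_ : _ `&` _ = set0) ?integral_set0//.
  by apply/seteqP; split => // w [_ /=] Mw; have := M0 w; rewrite Mw.
have far_good m : residual ip1 e f0 m <= residual ip1 e f0 j + theta ->
    (far m <= kappa%:E * evid m)%E.
  move=> Rm; have [->|m0] := posnP m.
    by rewrite far_level0 mule_ge0// lee_fin.
  apply: (le_trans (integral_likelihood_far_level f0 r0 m0)).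
  rewrite /evid integral_likelihood_level// -EFinM lee_fin.
  apply: ler_wpM2r.
    rewrite mulr_ge0 ?ltW ?h0// prodr_gt0// => k _; exact: tilt_mass_gt0.
  by rewrite ler_pM2r ?invr_gt0// -addrA lerD.
have far_all m : (far m <= kappa%:E * evid m + (if (m < j)%N then u%:E * evid j else 0))%E.
  case: ltnP => mj'; last first.
    rewrite adde0; apply: far_good.
    by rewrite (le_trans (residual_le _ _ _ mj'))// lerDl.
  have [Rm|Rm] := leP (residual ip1 e f0 m) (residual ip1 e f0 j + theta).
    rewrite (le_trans (far_good _ Rm))// leeDl// mule_ge0// lee_fin//.
  have [->|m0] := posnP m.
    by rewrite far_level0 adde_ge0// mule_ge0// lee_fin.
  rewrite (le_trans (far_evid m))// (@le_trans _ _ (u%:E * evid j)%E)//.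
    rewrite /evid !integral_likelihood_level// -EFinM lee_fin.
    by apply: mj => //; rewrite m0.
  by rewrite leeDr// mule_ge0// lee_fin.
apply: (@le_trans _ _ (\sum_(m <oo) (kappa%:E * evid m +
    (if (m < j)%N then u%:E * evid j else 0)))%E).
  by apply: lee_nneseries => [m _ _|m _]; [exact: far0|exact: far_all].
have ite0 m : (0 <= if (m < j)%N then u%:E * evid j else 0)%E.
  by case: ifP => // _; rewrite mule_ge0.
rewrite nneseriesD => [|m _ _|m _ _]; last 2 first.
- by rewrite mule_ge0.
- exact: ite0.
rewrite nneseriesZl// EFinD ge0_muleDl//; last by rewrite lee_fin mulr_ge0.
apply: leeD2l.
rewrite [leLHS](_ : _ = ((j%:R * u)%:E * evid j)%E).
  apply: lee_wpmul2l; first by rewrite lee_fin mulr_ge0.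
  by rewrite -evidence_sum; exact: evidence_ge_level.
rewrite (nneseries_split 0 j)// add0n [X in (_ + X)%E]eseries0 => [|m jm _]; last first.
  by rewrite ltnNge jm.
rewrite adde0 big_mkord (eq_bigr (fun=> u%:E * evid j)%E) => [|m _].
  have -> : evid j = (h j * \prod_(k < j) Z k)%:E by exact: integral_likelihood_level.
  by rewrite sumEFin sumr_const card_ord -[RHS]EFinM -mulrA mulr_natl.
by rewrite ltn_ord.
Qed.

(** Clearing the denominator turns the event into a comparison of two measurable
    functions of the data. An infinite evidence makes the quotient 0, and the
    right-hand side false. *)
Lemma posterior_gt_event (eps : R) (D : set H1) : 0 < eps ->
  ((eps%:E < `|posterior ip1 e rho A n Pi Y D|) =
   (eps%:E * (\int[Pi]_(f in topological_support Pi) (L f)%:E) <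
    \int[Pi]_(f in D) (L f)%:E))%E.
Proof.
move=> eps0; rewrite /posterior -/L.
have : (0 <= \int[Pi]_(f in D) (L f)%:E)%E.
  by apply: integral_ge0 => f _; rewrite lee_fin; exact: likelihood_ge0.
have := evidence_gt0.
move: (\int[Pi]_(f in topological_support Pi) (L f)%:E)%E => E.
move: (\int[Pi]_(f in D) (L f)%:E)%E => N.
case: E => [E| |]//= E0 N0.
  rewrite lte_fin in E0; rewrite inver gt_eqF// gee0_abs.
    by rewrite lte_pdivlMr.
  by rewrite mule_ge0// lee_fin invr_ge0 ltW.
rewrite invey mule0 abse0 gt0_muley ?lte_fin//.
by rewrite [RHS]ltNge leey ltNge (ltW eps0).
Qed.

End Sieve.

(** * Exponentials, powers and series *)

Section ExpVersusPower.
Context {R : realType}.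
Implicit Types a eps eta x : R.

Lemma powR_le_expR a eps : 0 <= a -> 0 < eps ->
  exists2 K, 0 < K & forall x, 0 < x -> x `^ a <= K * expR (eps * x).
Proof.
rewrite le_eqVlt => /predU1P[<-|a0] eps0.
  exists 1 => // x x0; rewrite powRr0 mul1r -[leLHS]expR0 ler_expR.
  by rewrite mulr_ge0 ?ltW.
pose s := eps / a; have s0 : 0 < s by rewrite divr_gt0.
exists (expR (- a * ln s)); first exact: expR_gt0.
move=> x x0; rewrite /powR gt_eqF// -expRD ler_expR.
have : ln (s * x) <= s * x by rewrite ltW// ln_sublinear// mulr_gt0.
rewrite lnM ?posrE// => /(ler_wpM2l (ltW a0)).
by rewrite /s mulrA [a * (_ / _)]mulrC divfK ?gt_eqF//; lra.
Qed.

(** The power of x takes half of the exponential, the constants take the other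
    half. *)
Lemma near_powR_le_expR a eps K eta : 0 <= a -> 0 < eps -> 0 < eta ->
  \forall x \near +oo, K * x `^ a <= eta * expR (eps * x).
Proof.
move=> a0 eps0 eta0; have e2 : 0 < eps / 2 by rewrite divr_gt0.
have [K' K'0 HK'] := powR_le_expR a0 e2.
near=> x; have x0 : 0 < x by near: x; exact: nbhs_pinfty_gt.
have Kx : `|K| * K' / eta <= expR (eps / 2 * x).
  apply: (@le_trans _ _ (eps / 2 * x)); last first.
    by apply: le_trans (expR_ge1Dx _); rewrite lerDr.
  rewrite [leRHS]mulrC -ler_pdivrMr//; near: x; apply: nbhs_pinfty_ge; rewrite num_real.
rewrite ler_pdivrMr// in Kx.
apply: (@le_trans _ _ (`|K| * (K' * expR (eps / 2 * x)))).
  apply: (@le_trans _ _ (`|K| * x `^ a)).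
    by rewrite ler_wpM2r ?powR_ge0// ler_norm.
  by rewrite ler_wpM2l// HK'.
rewrite mulrA (_ : eps * x = eps / 2 * x + eps / 2 * x); last by field.
rewrite expRD mulrA; apply: ler_wpM2r; first exact: expR_ge0.
by rewrite [leRHS]mulrC.
Unshelve. all: by end_near. Qed.

Lemma ln_natr_cvgy : (fun n : nat => ln (n%:R : R)) @ \oo --> +oo.
Proof.
apply/cvgryPge => B; near=> n.
rewrite -(expRK B) ler_ln ?posrE ?expR_gt0//; last by rewrite ltr0n; near: n; exact: nbhs_infty_gt.
near: n; exact: nbhs_infty_ger.
Unshelve. all: by end_near. Qed.

End ExpVersusPower.

Section Series.
Context {R : realType}.
Implicit Types (u v : nat -> R) (c : R).

(** For k >= 2 the bound k^(-1-b) <= ((k-1)^(-b) - k^(-b)) / b telescopes. *)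
Lemma sum_powR_le b : 0 < b -> forall n,
  \sum_(k < n) (k.+1%:R : R) `^ (- (1 + b)) <= 1 + b^-1.
Proof.
move=> b0.
have step k : ((k.+2%:R : R) `^ (- (1 + b))) <=
    b^-1 * (k.+1%:R `^ (- b) - k.+2%:R `^ (- b)).
  have k1 : (0 : R) < k.+1%:R by rewrite ltr0n.
  have k2 : (0 : R) < k.+2%:R by rewrite ltr0n.
  rewrite ler_pdivlMl// opprD powRD; last by apply/implyP => _; rewrite gt_eqF.
  rewrite powR_inv1; last exact: ltW.
  have -> : (k.+1%:R : R) `^ (- b) =
      k.+2%:R `^ (- b) * expR (b * (ln k.+2%:R - ln k.+1%:R)).
    by rewrite /powR !gt_eqF// -expRD; congr expR; ring.
  have l1 : (k.+2%:R : R)^-1 <= ln k.+2%:R - ln k.+1%:R.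
    have : ln (1 + (- (k.+2%:R : R)^-1)) <= - (k.+2%:R : R)^-1.
      by apply: le_ln1Dx; rewrite ltrN2 invf_lt1// ltr1n.
    have -> : 1 + (- (k.+2%:R : R)^-1) = k.+1%:R / k.+2%:R.
      by rewrite -[k.+2%:R]natr1; field; apply/lt0r_neq0; have := ler0n R k; lra.
    by rewrite ln_div ?posrE// lerNr opprB.
  have p0 : (0 : R) <= k.+2%:R `^ (- b) by exact: powR_ge0.
  set E := expR _; set P := k.+2%:R `^ (- b); set i := k.+2%:R^-1.
  have bi : b * i <= E - 1.
    rewrite lerBrDl; apply: le_trans (expR_ge1Dx _).
    by rewrite lerD2l ler_wpM2l// ltW.
  rewrite (_ : b * (i * P) = P * (b * i)); last by ring.
  rewrite (_ : P * E - P = P * (E - 1)); last by ring.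
  by rewrite ler_wpM2l.
move=> [|n]; first by rewrite big_ord0 addr_ge0// invr_ge0 ltW.
rewrite big_ord_recl/= powR1 lerD2l//.
apply: (@le_trans _ _ (\sum_(k < n) b^-1 * (k.+1%:R `^ (- b) - k.+2%:R `^ (- b)))).
  by apply: ler_sum => k _; exact: step.
rewrite -mulr_sumr ler_piMr ?invr_ge0 ?(ltW b0)//.
rewrite -(big_mkord xpredT (fun k => k.+1%:R `^ (- b) - k.+2%:R `^ (- b))).
under eq_bigr do rewrite -opprB.
rewrite sumrN (telescope_sumr (fun k => (k.+1%:R : R) `^ (- b)))// opprB powR1.
by rewrite lerBlDr lerDl powR_ge0.
Qed.

Lemma bounded_series_tail u B eta : (forall k, 0 <= u k) ->
  (forall n, \sum_(k < n) u k <= B) -> 0 < eta ->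
  exists J, forall j m, (J <= j)%N -> \sum_(j <= k < m) u k <= eta.
Proof.
move=> u0 uB eta0.
have nd : nondecreasing_seq (fun n => \sum_(k < n) u k).
  by apply/nondecreasing_seqP => n; rewrite big_ord_recr/= lerDl.
have cu : cvgn (fun n => \sum_(k < n) u k).
  by apply: nondecreasing_is_cvgn => //; exists B => _ [n _ <-].
have [J _ HJ] := (cvgrPdist_le _ _).1 cu eta eta0.
exists J => j m Jj.
have [mj|jm] := leqP m j; first by rewrite big_geq// ltW.
have ul n : \sum_(k < n) u k <= limn (fun n => \sum_(k < n) u k).
  exact: nondecreasing_cvgn_le.
have := HJ j Jj; rewrite ger0_norm ?subr_ge0//; apply: le_trans.
have -> : \sum_(j <= k < m) u k = \sum_(k < m) u k - \sum_(k < j) u k.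
  rewrite -!(big_mkord xpredT u) (big_cat_nat (n := j) (leq0n j) (ltnW jm))/=.
  by rewrite addrC addrK.
by rewrite lerD2r.
Qed.

(** Finitely many positive terms only change the constant. *)
Lemma near_dominated u v c : 0 < c -> (forall k, 0 < u k) -> (forall k, 0 < v k) ->
  (\forall k \near \oo, c * v k <= u k) ->
  exists2 c', 0 < c' & forall k, c' * v k <= u k.
Proof.
move=> c0 u0 v0 [N _ HN].
elim: N c c0 HN => [|N IH] c c0 HN; first by exists c => // k; exact: HN.
apply: (IH (Num.min c (u N / v N))).
  by rewrite lt_min c0 divr_gt0.
move=> k /= Nk; have [<-|Nk'] := eqVneq N k.
  by rewrite -ler_pdivlMr// ge_min lexx orbT.
apply: (le_trans _ (HN k _)); last by rewrite /= ltn_neqAle Nk'.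
by rewrite ler_wpM2r ?ge_min ?lexx// ltW.
Qed.

End Series.

(** * Choice of the truncation level *)

Section Asymptotics.
Context {R : realType}.
Variables (rho tau f h : nat -> R) (resid : nat -> R).
Variables (beta p b B1 K c c1 Sd : R).
Hypotheses (beta0 : 0 < beta) (p0 : 0 <= p) (b0 : 0 < b) (B10 : 0 < B1).
Hypotheses (c0 : 0 < c) (c10 : 0 < c1).
Hypothesis tau_gt0 : forall k, 0 < tau k.
Hypothesis tau_le1 : forall k, tau k <= 1.
Hypothesis rhoK : forall k, rho k ^+ 2 <= K.
Hypothesis obs : forall k,
  c * expR (- (c1 * k.+1%:R `^ beta)) <= rho k ^+ 2 * tau k ^+ 2.
Let energy k := tau k ^+ 2 + f k ^+ 2.
Hypothesis energyS : forall m,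
  \sum_(k < m) energy k * (1 + k.+1%:R ^+ 2) `^ p <= Sd.
Hypothesis h_ge : forall m, (0 < m)%N ->
  B1 * expR (- b * m%:R `^ (beta + 1)) <= h m.
Hypothesis h_le1 : forall m, (0 < m)%N -> h m <= 1.
Hypothesis resid_sum : forall m j, (m <= j)%N ->
  resid m = resid j + \sum_(m <= k < j) f k ^+ 2.
Hypothesis resid0 : resid @ \oo --> 0.

(* [y x] is the largest real k with c1 k^beta <= x / 2 for x = ln n, so that the
   bound [obs] leaves a_k at least c n^(1/2); [lam x] bounds half the logarithm
   of 1 + a_k. *)
Let q := beta^-1.
Let y x : R := (x / (2 * c1)) `^ q.
Let lam x : R := (ln (1 + K) + x) / 2.

Let q0 : 0 < q. Proof. by rewrite invr_gt0. Qed.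
Let K0 : 0 <= K. Proof. exact: le_trans (sqr_ge0 (rho 0)) (rhoK 0). Qed.
Let lnK0 : 0 <= ln (1 + K). Proof. by rewrite ln_ge0// lerDl. Qed.
Let cc0 : 0 < 2 * c1. Proof. by rewrite mulr_gt0. Qed.

Let yE x : 0 < x -> y x = ((2 * c1)^-1) `^ q * x `^ q.
Proof. by move=> x0; rewrite /y mulrC powRM// ?invr_ge0 ltW. Qed.

(** Every cost is a power of x or exp (x / 8), hence negligible against
    exp (x / 2) exp (- (x / 4)) = exp (x / 4). *)
Lemma near_truncation_weight eta : 0 < eta -> \forall x \near +oo,
  forall j : nat, j%:R <= y x ->
  j%:R * (B1^-1 * expR (b * j%:R `^ (beta + 1) + (j%:R * lam x
    - c * expR (x / 2) * expR (- (x / 4)) / 8 + expR (x / 8) / 4))) <= eta.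
Proof.
move=> eta0; pose D := ((2 * c1)^-1) `^ q; pose kap := c / 64.
have D0 : 0 <= D by exact: powR_ge0.
have kap0 : 0 < kap by rewrite divr_gt0.
near=> x.
have x1 : 1 <= x by near: x; apply: nbhs_pinfty_ge; rewrite num_real.
have x0 : 0 < x by exact: lt_le_trans x1.
have E1 : D * x `^ q <= kap * expR (4^-1 * x).
  by near: x; apply: near_powR_le_expR => //; rewrite ltW.
have E2 : b * D `^ (beta + 1) * x `^ (q * (beta + 1)) <= kap * expR (4^-1 * x).
  near: x; apply: near_powR_le_expR => //.
  by rewrite mulr_ge0 ?addr_ge0// ltW.
have E3 : D * (ln (1 + K) + 1) / 2 * x `^ (q + 1) <= kap * expR (4^-1 * x).
  by near: x; apply: near_powR_le_expR => //; rewrite addr_ge0// ltW.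
have E4 : 1 * x `^ 1 <= kap * expR (4^-1 * x) by near: x; apply: near_powR_le_expR.
have E5 : 4^-1 * x `^ 0 <= kap * expR (8^-1 * x).
  by near: x; apply: near_powR_le_expR.
have Eeta : - ln (eta * B1) <= x by near: x; apply: nbhs_pinfty_ge; rewrite num_real.
pose E := expR (4^-1 * x).
move=> j; rewrite yE// -/D => jy.
have j0 : (0 : R) <= j%:R by [].
have J1 : j%:R <= kap * E by exact: le_trans jy E1.
have J2 : b * j%:R `^ (beta + 1) <= kap * E.
  apply: le_trans E2; rewrite -mulrA; apply: ler_wpM2l; first exact: ltW.
  rewrite powRrM -powRM ?powR_ge0//; apply: ge0_ler_powR => //.
  - by rewrite addr_ge0// ltW.
  - by rewrite nnegrE mulr_ge0// powR_ge0.
have J3 : j%:R * lam x <= kap * E.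
  apply: le_trans E3; rewrite powRD; last by apply/implyP => _; rewrite gt_eqF.
  rewrite powRr1 ?(ltW x0)// (_ : _ * (_ * x) =
    (D * x `^ q) * ((ln (1 + K) + 1) * x / 2)); last by ring.
  have lam_ge0 : 0 <= lam x by rewrite divr_ge0// addr_ge0// ltW.
  apply: ler_pM => //; rewrite /lam ler_wpM2r//.
  by rewrite mulrDl mul1r lerD// ler_peMr.
have J4 : x <= kap * E by move: E4; rewrite mul1r powRr1 ?(ltW x0).
have J5 : expR (x / 8) / 4 <= kap * E.
  move: E5; rewrite powRr0 mulr1 => /(ler_wpM2l (expR_ge0 (8^-1 * x))).
  rewrite [x / 8]mulrC; move=> /le_trans; apply; rewrite mulrCA.
  by rewrite -expRD (_ : 8^-1 * x + 8^-1 * x = 4^-1 * x)//; field.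
have GE : c * expR (x / 2) * expR (- (x / 4)) / 8 = 8 * (kap * E).
  have -> : E = expR (x / 2) * expR (- (x / 4)).
    by rewrite -expRD /E; congr expR; field.
  by rewrite /kap; field.
rewrite GE; have kE0 : 0 <= kap * E by rewrite mulr_ge0 ?expR_ge0// ltW.
set ex := b * _ + _.
have exE : ex <= - x - j%:R by rewrite /ex; lra.
apply: (@le_trans _ _ (B1^-1 * expR (- x))).
  rewrite mulrCA ler_pM2l ?invr_gt0//.
  apply: (@le_trans _ _ (expR j%:R * expR (- x - j%:R))).
    apply: ler_pM => //; rewrite ?expR_ge0 ?ler_expR//.
    by apply: le_trans (expR_ge1Dx _); rewrite lerDr.
  by rewrite -expRD addrC subrK.
rewrite ler_pdivrMl// mulrC -[leRHS]lnK ?posrE ?mulr_gt0// ler_expR.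
by rewrite lerNl.
Unshelve. all: by end_near. Qed.

Let rate x : R := x `^ (- (p / beta)).

Let rateE x : 0 < x -> (rate x ^+ 2)^-1 = x `^ (q * (2 * p)).
Proof.
move=> x0; rewrite /rate -powR_mulrn ?powR_ge0// -powRrM -powRN /q.
by congr (_ `^ _); field; rewrite gt_eqF.
Qed.

Let w1 k : 1 <= (1 + (k.+1%:R : R) ^+ 2) `^ p.
Proof. by rewrite -[leLHS](powRr0 (1 + k.+1%:R ^+ 2)) ler_powR// lerDl sqr_ge0. Qed.

Let energy_ge0 k : 0 <= energy k. Proof. by rewrite addr_ge0// sqr_ge0. Qed.

Lemma sum_energy_le m : \sum_(k < m) energy k <= Sd.
Proof.
by apply: le_trans (energyS m); apply: ler_sum => k _; rewrite ler_peMr.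
Qed.

(** A convergent series with increasing weights: its tails are o of the inverse
    weight, which is what makes every C >= 1 admissible. *)
Lemma sum_energy_tail eta : 0 < eta -> exists J : nat, forall j m, (J <= j)%N ->
  \sum_(j <= k < m) energy k <= eta * j.+1%:R `^ (- (2 * p)).
Proof.
move=> eta0.
have u0 k : 0 <= energy k * (1 + (k.+1%:R : R) ^+ 2) `^ p by rewrite mulr_ge0 ?powR_ge0.
have [J HJ] := bounded_series_tail u0 energyS eta0.
exists J => j m Jj; have jp : 0 < (j.+1%:R : R) `^ (2 * p) by rewrite powR_gt0.
rewrite powRN ler_pdivlMr// mulr_suml; apply: le_trans (HJ j m Jj).
rewrite big_nat_cond [leRHS]big_nat_cond; apply: ler_sum => k.
rewrite andbT => /andP[jk _]; apply: ler_wpM2l => //.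
rewrite powRrM; apply: ge0_ler_powR => //; rewrite ?nnegrE ?powR_ge0//.
rewrite (powR_mulrn 2)//; apply: (@le_trans _ _ (k.+1%:R ^+ 2)); last by rewrite lerDr.
by rewrite lerXn2r ?nnegrE// ler_nat.
Qed.

Lemma sum_if_ge (d : nat -> R) j m :
  \sum_(k < m) (if (k < j)%N then 0 else d k) = \sum_(j <= k < m) d k.
Proof.
elim: m => [|m IH]; first by rewrite big_ord0 big_geq.
rewrite big_ord_recr/= IH; case: ltnP => mj; last by rewrite big_nat_recr.
by rewrite addr0 !big_geq// ltnW.
Qed.

Lemma sum_if_lt (v : R) j m : 0 <= v ->
  \sum_(k < m) (if (k < j)%N then v else 0) <= j%:R * v.
Proof.
move=> v0; apply: (@le_trans _ _ ((minn m j)%:R * v)); last first.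
  by rewrite ler_wpM2r// ler_nat geq_minr.
elim: m => [|m IH]; first by rewrite big_ord0 min0n mul0r.
rewrite big_ord_recr/=; case: ltnP => mj.
  by rewrite (minn_idPl mj) -natr1 mulrDl mul1r lerD2r (le_trans IH)// (minn_idPl (ltnW mj)).
by rewrite addr0 (le_trans IH)// ler_wpM2r// ler_nat leq_min geq_minr geq_min leqnSn.
Qed.

Lemma resid_le j B : (forall m, \sum_(j <= k < m) f k ^+ 2 <= B) -> resid j <= B.
Proof.
move=> fB; rewrite -[leRHS]add0r -lerBlDr.
rewrite -(cvg_lim _ resid0)//.
apply: limr_ge; first by apply/cvg_ex; exists 0.
exists j => // m /= jm.
by rewrite (resid_sum jm) lerBlDr lerD2l.
Qed.

(** The level j is the integer part of [y (ln n)]; the slack theta is n^(-1/4),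
    the noise budget X is n^(1/8), and u bounds the mass of a level with a large
    bias relative to that of j. *)
Lemma truncation_level_exists eta : 0 < eta -> \forall n \near \oo,
  exists (j : nat) (theta u X : R), [/\ (0 < j)%N, 0 <= theta, 0 <= u & 0 < X] /\
  [/\ 0 < rate (ln n%:R),
     forall m, \sum_(k < m)
       (12 * (energy k / (1 + n%:R * rho k ^+ 2 * tau k ^+ 2)) / rate (ln n%:R) ^+ 2 +
        (if (k < j)%N then X^-1 else 0)) <= eta,
     (resid j + theta) / rate (ln n%:R) ^+ 2 + j%:R * u <= eta &
     forall xi : nat -> R, \sum_(k < j) xi k ^+ 2 <= X ->
     let Z k := tilt_mass (tau k) (n%:R * rho k ^+ 2)
       (n%:R * rho k * (rho k * f k + (Num.sqrt n%:R)^-1 * xi k)) in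
     forall m, (0 < m < j)%N -> resid j + theta < resid m ->
       h m * \prod_(k < m) Z k <= u * (h j * \prod_(k < j) Z k)].
Proof.
move=> eta0.
pose M := (2 * c1) `^ (q * (2 * p)).
have M0 : 0 < M by rewrite powR_gt0.
(* The tails carry the factors 12 and M, and make up one of three parts. *)
pose eta' := eta / (36 * M).
have eta'0 : 0 < eta' by rewrite divr_gt0// mulr_gt0.
have [J HJ] := sum_energy_tail eta'0.
have eta3 : 0 < eta / 3 by rewrite divr_gt0.
have Sd0 : 0 <= Sd by apply: le_trans (sum_energy_le 0); rewrite big_ord0.
have pq0 : 0 <= q * (2 * p) by rewrite !mulr_ge0// ltW.
have ln_near (P : R -> Prop) : (\forall x \near +oo, P x) ->
    \forall n \near \oo, P (ln (n%:R : R)) by move=> HP; exact: ln_natr_cvgy HP.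
near=> n.
have n0 : (0 < n)%N by near: n; exact: nbhs_infty_gt.
have x1 : 1 <= ln (n%:R : R).
  near: n; apply: (ln_near (fun x => 1 <= x)).
  by apply: nbhs_pinfty_ge; rewrite num_real.
have xJ : 2 * c1 * J.+1%:R `^ beta <= ln (n%:R : R).
  near: n; apply: (ln_near (fun x => _ <= x)).
  by apply: nbhs_pinfty_ge; rewrite num_real.
have c_ge1 : 1 * ln (n%:R : R) `^ 0 <= c * expR (2^-1 * ln (n%:R : R)).
  near: n; apply: (ln_near (fun x => 1 * x `^ 0 <= c * expR (2^-1 * x))).
  exact: near_powR_le_expR.
have N1 : 12 * Sd / c * ln (n%:R : R) `^ (q * (2 * p)) <=
    eta / 3 * expR (2^-1 * ln (n%:R : R)).
  near: n; apply: (ln_near (fun x => _ * x `^ _ <= _ * expR (2^-1 * x))).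
  exact: near_powR_le_expR.
have N2 : (2 * c1)^-1 `^ q * ln (n%:R : R) `^ q <=
    eta / 3 * expR (8^-1 * ln (n%:R : R)).
  near: n; apply: (ln_near (fun x => _ * x `^ _ <= _ * expR (8^-1 * x))).
  by apply: near_powR_le_expR => //; exact: ltW.
have N3 : 1 * ln (n%:R : R) `^ (q * (2 * p)) <=
    eta / 3 * expR (4^-1 * ln (n%:R : R)).
  near: n; apply: (ln_near (fun x => 1 * x `^ _ <= _ * expR (4^-1 * x))).
  exact: near_powR_le_expR.
have N4 : forall j : nat, j%:R <= y (ln (n%:R : R)) ->
    j%:R * (B1^-1 * expR (b * j%:R `^ (beta + 1) + (j%:R * lam (ln (n%:R : R))
    - c * expR (ln (n%:R : R) / 2) * expR (- (ln (n%:R : R) / 4)) / 8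
    + expR (ln (n%:R : R) / 8) / 4))) <= eta / 3.
  near: n; exact: (ln_near _ (near_truncation_weight eta3)).
have nE : n%:R = expR (ln (n%:R : R)) by rewrite lnK// posrE ltr0n.
set x := ln (n%:R : R) in x1 xJ c_ge1 nE N1 N2 N3 N4 *.
have x0 : 0 < x by exact: lt_le_trans x1.
pose j := Num.truncn (y x).
have y0 : 0 <= y x by exact: powR_ge0.
have /andP[jy yj] := truncn_itv y0.
have [j0 Jj] : (0 < j)%N /\ (J <= j)%N.
  have yJ : J.+1%:R <= y x.
    have Jb : (J.+1%:R : R) `^ beta <= x / (2 * c1).
      by rewrite ler_pdivlMr// mulrC.
    have -> : (J.+1%:R : R) = (J.+1%:R `^ beta) `^ q.
      by rewrite -powRrM /q mulfV ?gt_eqF// powRr1.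
    apply: ge0_ler_powR; rewrite ?nnegrE ?powR_ge0 ?(ltW q0)//.
    by rewrite divr_ge0// ltW.
  have : (J.+1%:R : R) < j.+1%:R by exact: le_lt_trans yj.
  by rewrite ltr_nat ltnS => /[dup] /(leq_ltn_trans (leq0n J)) ? /ltnW.
have jE (k : nat) : (k < j)%N -> c1 * k.+1%:R `^ beta <= x / 2.
  move=> kj; have : k.+1%:R <= y x by apply: le_trans jy; rewrite ler_nat.
  move=> /(ge0_ler_powR (ltW beta0) (ler0n _ _) y0).
  rewrite /y -powRrM /q mulVf ?gt_eqF// powRr1; last by rewrite divr_ge0 ?(ltW x0) ?(ltW cc0).
  by rewrite ler_pdivlMr//; lra.
pose a k := n%:R * rho k ^+ 2 * tau k ^+ 2.
have a0 k : 0 <= a k by rewrite mulr_ge0 ?sqr_ge0// mulr_ge0 ?sqr_ge0.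
have aj k : (k < j)%N -> c * expR (x / 2) <= a k.
  move=> kj; rewrite /a -mulrA nE.
  apply: le_trans (ler_wpM2l (expR_ge0 x) (obs k)).
  rewrite mulrCA; apply: ler_wpM2l; first exact: ltW.
  by rewrite -expRD ler_expR; have := jE k kj; lra.
rewrite powRr0 mulr1 [2^-1 * x]mulrC in c_ge1.
pose theta := expR (- (x / 4)); pose X := expR (x / 8).
pose u := (h j)^-1 * expR (j%:R * lam x - c * expR (x / 2) * theta / 8 + X / 4).
have hj : 0 < h j by rewrite (lt_le_trans _ (h_ge j0))// mulr_gt0// expR_gt0.
exists j, theta, u, X; split.
  by split => //; rewrite ?expR_ge0 ?expR_gt0// mulr_ge0 ?invr_ge0 ?expR_ge0// ltW.
have rt0 : 0 < rate x by exact: powR_gt0.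
have tailE : j.+1%:R `^ (- (2 * p)) * x `^ (q * (2 * p)) <= M.
  have -> : x = 2 * c1 * (x / (2 * c1)) by field; rewrite gt_eqF.
  rewrite powRM ?divr_ge0 ?(ltW x0) ?(ltW cc0)// -/M mulrCA ler_piMr ?(ltW M0)//.
  rewrite powRN (powRrM (x / _) q) -/(y x) mulrC ler_pdivrMr ?powR_gt0// mul1r.
  by apply: ge0_ler_powR; rewrite ?nnegrE ?mulr_ge0// ltW.
have irr0 : 0 <= x `^ (q * (2 * p)) by exact: powR_ge0.
set irr := x `^ (q * (2 * p)) in N1 N3 tailE irr0 *.
pose G := c * expR (x / 2).
have G0 : 0 < G by rewrite mulr_gt0// expR_gt0.
have tail_j m : irr * \sum_(j <= k < m) energy k <= eta' * M.
  apply: (@le_trans _ _ (irr * (eta' * j.+1%:R `^ (- (2 * p))))).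
    by rewrite ler_wpM2l// HJ.
  by rewrite mulrCA ler_pM2l// mulrC.
have eta'E : eta' * M = eta / 36 by rewrite /eta'; field; rewrite gt_eqF.
split => //.
- move=> m; rewrite big_split/=.
  have -> : \sum_(k < m) 12 * (energy k / (1 + n%:R * rho k ^+ 2 * tau k ^+ 2)) / rate x ^+ 2 =
      12 * (irr * \sum_(k < m) energy k / (1 + a k)).
    by rewrite 2!mulr_sumr; apply: eq_bigr => k _; rewrite rateE// -/irr -/(a k); ring.
  have S1 : \sum_(k < m) energy k / (1 + a k) <= Sd / G + \sum_(j <= k < m) energy k.
    apply: (@le_trans _ _ (\sum_(k < m) (energy k / G + if (k < j)%N then 0 else energy k))).
      apply: ler_sum => k _; have a1 : 0 < 1 + a k by rewrite ltr_pwDl.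
      case: ltnP => kj.
        rewrite addr0 ler_wpM2l// lef_pV2 ?posrE// (le_trans (aj _ kj))//.
        by rewrite lerDr.
      rewrite -[leLHS]add0r lerD//; first by rewrite divr_ge0// ltW.
      by rewrite ler_pdivrMr// ler_peMr// lerDl.
    rewrite big_split/= sum_if_ge lerD2r -mulr_suml ler_pM2r ?invr_gt0//.
    exact: sum_energy_le.
  have S2 : 12 * (irr * (Sd / G)) <= eta / 3.
    rewrite /G -[x / 2]mulrC in N1 *.
    rewrite (_ : _ * _ = 12 * Sd / c * irr / expR (2^-1 * x)); last first.
      by field; rewrite !gt_eqF// expR_gt0.
    by rewrite ler_pdivrMr ?expR_gt0.
  have S3 : \sum_(k < m) (if (k < j)%N then X^-1 else 0) <= eta / 3.
    have X0 : 0 < X by exact: expR_gt0.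
    apply: le_trans (sum_if_lt j m _) _; first by rewrite invr_ge0 ltW.
    rewrite ler_pdivrMr// (le_trans jy)// yE//.
    by rewrite /X [x / 8]mulrC.
  have := ler_wpM2l irr0 S1; rewrite mulrDr => S1'.
  have := tail_j m; lra.
- rewrite -/(irr) mulrDl rateE// -/irr.
  have R1 : resid j * irr <= eta / 36.
    have Rj : resid j <= eta' * j.+1%:R `^ (- (2 * p)).
      apply: resid_le => m; apply: le_trans (HJ j m Jj).
      by apply: ler_sum => k _; rewrite lerDr sqr_ge0.
    apply: le_trans (ler_wpM2r irr0 Rj) _.
    by rewrite -mulrA -eta'E ler_pM2l.
  have R2 : theta * irr <= eta / 3.
    rewrite /theta expRN mulrC ler_pdivrMr ?expR_gt0//.
    by rewrite [x / 4]mulrC; move: N3; rewrite mul1r.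
  have R3 : j%:R * u <= eta / 3.
    apply: le_trans (N4 j jy); apply: ler_wpM2l => //.
    rewrite expRD [leRHS]mulrA -/theta -/X /u.
    apply: ler_wpM2r; first exact: expR_ge0.
    have -> : B1^-1 * expR (b * j%:R `^ (beta + 1)) =
        (B1 * expR (- b * j%:R `^ (beta + 1)))^-1.
      by rewrite invfM mulNr expRN invrK.
    by rewrite lef_pV2 ?posrE ?h_ge// mulr_gt0// expR_gt0.
  lra.
- move=> xi xiX m /andP[m0 mj] Rm.
  pose Z k := tilt_mass (tau k) (n%:R * rho k ^+ 2)
    (n%:R * rho k * (rho k * f k + (Num.sqrt n%:R)^-1 * xi k)).
  suff : h m * \prod_(k < m) Z k <= u * (h j * \prod_(k < j) Z k) by [].
  have Zk k : (k < j)%N ->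
      expR (- lam x + G * f k ^+ 2 / 8 - xi k ^+ 2 / 4) <= Z k.
    move=> kj; apply: tilt_mass_ge => //.
    - exact: le_trans (aj _ kj).
    - rewrite (_ : 2 * lam x = ln (1 + K) + x); last by rewrite /lam; field.
      rewrite expRD lnK ?posrE ?ltr_pwDl// -nE.
      rewrite mulrDl mul1r lerD ?ler1n// -mulrA mulrC ler_wpM2r//.
      rewrite (le_trans _ (rhoK k))// ler_piMr ?sqr_ge0//.
      by rewrite exprn_ile1// ltW.
    - apply: le_trans (aj _ kj) _; rewrite /a ler_piMr//.
        by rewrite mulr_ge0 ?sqr_ge0.
      by rewrite exprn_ile1// ltW.
  have lam0 : 0 <= lam x by rewrite divr_ge0// addr_ge0// ltW.
  have thj : theta <= \sum_(m <= k < j) f k ^+ 2.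
    by move: Rm; rewrite (resid_sum (ltnW mj)) ltrD2l => /ltW.
  have := prod_mass_ge lam0 (ltW G0) Zk thj xiX.
  set P := \prod_(m <= k < j) Z k => HP.
  have Zm0 : 0 <= \prod_(k < m) Z k.
    apply: prodr_ge0 => k _; apply/ltW/tilt_mass_gt0.
    by rewrite mulr_ge0 ?sqr_ge0.
  have -> : \prod_(k < j) Z k = \prod_(k < m) Z k * P.
    rewrite -!(big_mkord xpredT Z) /P.
    by rewrite (big_cat_nat (n := m) (leq0n m) (ltnW mj)).
  rewrite mulrA [u * _](_ : _ = expR (j%:R * lam x - G * theta / 8 + X / 4)); last first.
    by rewrite /u mulrAC mulVf ?gt_eqF// mul1r.
  rewrite mulrCA [leLHS]mulrC; apply: ler_wpM2l => //.
  apply: le_trans (h_le1 m0) _.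
  apply: le_trans (ler_wpM2l (expR_ge0 _) HP).
  by rewrite -expRD -[leLHS]expR0 ler_expR; lra.
Unshelve. all: by end_near. Qed.

End Asymptotics.

(** * Severely ill-posed operators and polynomial scales *)

Section Scales.
Context {R : realType}.
Variables (beta delta : R) (rho tau : nat -> R).
Hypotheses (beta0 : 0 < beta) (delta_gt : beta / 2 < delta).
Hypothesis tau_def : forall k,
  tau k = (1 + k.+1%:R ^+ 2) `^ (- delta / 2 - 1 / 4).

Let s k : R := 1 + k.+1%:R ^+ 2.
Let s1 k : 1 <= s k. Proof. by rewrite lerDl sqr_ge0. Qed.
Let s0 k : 0 < s k. Proof. exact: lt_le_trans (s1 k). Qed.

Lemma scale_gt0 k : 0 < tau k. Proof. by rewrite tau_def powR_gt0. Qed.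

Lemma scale_le1 k : tau k <= 1.
Proof.
rewrite tau_def -[leRHS](powRr0 (s k)) (ler_powR (s1 k))//.
by have := beta0; have := delta_gt; lra.
Qed.

Lemma sqr_scale k : tau k ^+ 2 = s k `^ (- (delta + 1 / 2)).
Proof.
rewrite tau_def -/(s k) -powR_mulrn ?powR_ge0// -powRrM; congr (_ `^ _).
by field.
Qed.

(** Polynomial factors are absorbed in the exponential, at the price of a
    larger constant in its exponent. *)
Lemma ill_posed_lower : severely_ill_posed rho beta -> (forall k, rho k != 0) ->
  exists c c1 : R, [/\ 0 < c, 0 < c1 & forall k,
    c * expR (- (c1 * k.+1%:R `^ beta)) <= rho k ^+ 2 * tau k ^+ 2].
Proof.
move=> [_ [C1 [C2 [c0 [alpha0 [alpha1 [C10 C20 c00 rho_near]]]]]]] rho0.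
pose Q := `|alpha0 + delta + 1 / 2|.
have Q0 : 0 <= Q by exact: normr_ge0.
have [K K0 HK] := powR_le_expR (divr_ge0 (mulr_ge0 (ler0n R 2) Q0) (ltW beta0)) ltr01.
pose c := C1 ^+ 2 / (2 `^ Q * K).
have c_gt0 : 0 < c by rewrite divr_gt0 ?exprn_gt0// mulr_gt0// powR_gt0.
pose c1 := 2 * c0 + 1.
have c10 : 0 < c1 by rewrite addr_gt0// mulr_gt0.
have u0 k : 0 < rho k ^+ 2 * tau k ^+ 2.
  rewrite mulr_gt0//; last by rewrite exprn_gt0// scale_gt0.
  by rewrite lt_def sqrf_eq0 rho0 sqr_ge0.
have [|c' c'0 Hc'] := near_dominated c_gt0 u0 (fun k => expR_gt0 (- (c1 * k.+1%:R `^ beta))).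
  apply: filterS rho_near => k [Hk _].
  set t := k.+1%:R `^ beta in Hk *.
  have t0 : 0 < t by rewrite powR_gt0.
  have sQ : s k `^ Q <= 2 `^ Q * K * expR t.
    apply: (@le_trans _ _ ((2 * k.+1%:R ^+ 2) `^ Q)).
      apply: ge0_ler_powR => //; rewrite ?nnegrE ?(ltW (s0 k)) ?mulr_ge0 ?sqr_ge0//.
      by rewrite /s mulr2n mulrDl mul1r lerD2r expr_ge1// ler1n.
    rewrite powRM ?sqr_ge0// -mulrA ler_wpM2l ?powR_ge0//.
    have := HK t t0; rewrite mul1r; apply: le_trans.
    rewrite -powR_mulrn// -powRrM /t -powRrM le_eqVlt; apply/orP; left; apply/eqP.
    by congr (_ `^ _); field; rewrite gt_eqF.
  have rho2 : (C1 * s k `^ (- alpha0 / 2) * expR (- c0 * t)) ^+ 2 <= rho k ^+ 2.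
    rewrite -[rho k ^+ 2]real_normK ?num_real// lerXn2r ?nnegrE//.
    by rewrite !mulr_ge0 ?powR_ge0 ?expR_ge0// ltW.
  apply: le_trans (ler_wpM2r (sqr_ge0 (tau k)) rho2).
  rewrite sqr_scale !exprMn -[s k `^ _ ^+ 2]powR_mulrn ?powR_ge0// -powRrM.
  rewrite -expRM_natl [leRHS]mulrAC.
  rewrite (_ : - (c1 * t) = - t + 2%:R * (- c0 * t)); last by rewrite /c1; ring.
  rewrite expRD mulrA ler_wpM2r ?expR_ge0//.
  rewrite -[leRHS]mulrA -powRD; last by apply/implyP => _; rewrite gt_eqF.
  rewrite /c -mulrA ler_wpM2l ?sqr_ge0//.
  apply: (@le_trans _ _ (s k `^ (- Q))).
    rewrite powRN -[leLHS]mulrC expRN -invfM lef_pV2 ?posrE ?powR_gt0//.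
      by rewrite mulrC.
    by rewrite mulr_gt0 ?expR_gt0// mulr_gt0// powR_gt0.
  rewrite (ler_powR (s1 k))//.
  have := ler_norm (alpha0 + delta + 1 / 2); rewrite -/Q; lra.
by exists c', c1.
Qed.

(** After multiplication by the weights, tau_k^2 is at most
    (k + 1)^(-(1 + beta)). *)
Lemma scale_series_bounded (p gamma Sf : R) (f : nat -> R) :
  p <= delta - beta / 2 -> p <= gamma ->
  (forall m, \sum_(k < m) f k ^+ 2 * s k `^ gamma <= Sf) ->
  exists Sd, forall m, \sum_(k < m) (tau k ^+ 2 + f k ^+ 2) * s k `^ p <= Sd.
Proof.
move=> pd pg fS; exists (1 + beta^-1 + Sf) => m.
under eq_bigr do rewrite mulrDl.
rewrite big_split/= lerD//; last first.
  apply: le_trans (fS m); apply: ler_sum => k _.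
  by rewrite ler_wpM2l ?sqr_ge0// ler_powR.
apply: le_trans (sum_powR_le beta0 m); apply: ler_sum => k _.
rewrite sqr_scale -powRD; last by apply/implyP => _; rewrite gt_eqF.
apply: (@le_trans _ _ (s k `^ (- ((1 + beta) / 2)))); first by rewrite (ler_powR (s1 k))//; lra.
rewrite !powRN lef_pV2 ?posrE ?powR_gt0//.
apply: (@le_trans _ _ ((k.+1%:R ^+ 2) `^ ((1 + beta) / 2))).
  rewrite -powR_mulrn// -powRrM le_eqVlt; apply/orP; left; apply/eqP.
  by congr (_ `^ _); field.
apply: ge0_ler_powR; rewrite ?nnegrE ?sqr_ge0 ?(ltW (s0 k))//.
  by rewrite divr_ge0// addr_ge0// ltW.
by rewrite lerDr.
Qed.

End Scales.

(** * Second moments of the noise *)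

Section WeightedSquares.
Context {R : realType} d (W : measurableType d) (P : probability W R).
Variables (xi : nat -> {RV P >-> R}) (v : nat -> R) (eta delta : R).
Hypothesis xi2 : forall k, ('E_P[(fun w => (xi k w * xi k w)%R)] = 1)%E.
Hypotheses (v0 : forall k, 0 <= v k) (delta0 : 0 < delta).
Hypothesis v_eta : forall m, \sum_(k < m) v k <= eta.

Definition weighted_squares w : \bar R :=
  (\sum_(k <oo) (v k * (1 + xi k w ^+ 2))%:E)%E.

Let term_ge0 k w : 0 <= v k * (1 + xi k w ^+ 2).
Proof. by rewrite mulr_ge0// addr_ge0// sqr_ge0. Qed.

Let term_meas k : measurable_fun setT (fun w => (v k * (1 + xi k w ^+ 2))%:E).
Proof.
apply/measurable_EFinP; apply: measurable_funM => //.
by apply: measurable_funD => //; exact: measurable_funX.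
Qed.

Lemma measurable_weighted_squares : measurable_fun setT weighted_squares.
Proof.
apply: ge0_emeasurable_sum => [k w _ _|k _]; last exact: term_meas.
by rewrite lee_fin.
Qed.

Lemma weighted_squares_ge0 w : (0 <= weighted_squares w)%E.
Proof. by apply: nneseries_ge0 => k _ _; rewrite lee_fin. Qed.

Lemma integral_weighted_squares_le :
  (\int[P]_w weighted_squares w <= (2 * eta)%:E)%E.
Proof.
rewrite /weighted_squares integral_nneseries//; last by move=> k w _; rewrite lee_fin.
have E k : (\int[P]_w (v k * (1 + xi k w ^+ 2))%:E = (2 * v k)%:E)%E.
  under eq_integral do rewrite EFinM EFinD.
  have mxi2 : measurable_fun setT (fun w => (xi k w ^+ 2)%:E).
    by apply/measurable_EFinP; exact: measurable_funX.
  have xi_ge0 w : (0 <= (xi k w ^+ 2)%:E)%E by rewrite lee_fin sqr_ge0.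
  rewrite ge0_integralZl//; first last.
  - by rewrite lee_fin.
  - by move=> w _; rewrite adde_ge0.
  - exact: emeasurable_funD.
  rewrite ge0_integralD// integral_cst// mul1e.
  rewrite [X in (_ * (X + _))%E](_ : _ = 1%E); last exact: probability_setT.
  have -> : (\int[P]_w (xi k w ^+ 2)%:E = 1)%E.
    rewrite -(xi2 k) unlock; apply: eq_integral => w _.
    by rewrite expr2.
  by rewrite -EFinD -EFinM mulrC.
apply: lime_le; first by apply: is_cvg_nneseries => k _ _; apply: integral_ge0 => w _; rewrite lee_fin.
apply: nearW => m; rewrite big_mkord; under eq_bigr do rewrite E.
by rewrite sumEFin lee_fin -mulr_sumr ler_pM2l.
Qed.

(** Markov's inequality, since E (1 + xi_k^2) = 2. *)
Lemma prob_weighted_squares_ge :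
  (P [set w | delta%:E <= weighted_squares w] <= (2 * eta / delta)%:E)%E.
Proof.
have := @le_integral_comp_abse _ W R P setT measurableT weighted_squares delta id
  _ (fun r r0 => r0) _ measurable_weighted_squares delta0.
move=> /(_ (@measurable_id _ _ _) (fun x y _ _ xy => xy)).
rewrite setTI.
under eq_set do rewrite gee0_abs ?weighted_squares_ge0//.
under eq_integral do rewrite gee0_abs ?weighted_squares_ge0//.
move=> /le_trans /(_ integral_weighted_squares_le).
by rewrite muleC => H; rewrite [leRHS]EFinM lee_pdivlMr.
Qed.

End WeightedSquares.

(** * Contraction of the posterior *)

Lemma prob_squeeze0 {R : realType} d (W : measurableType d)
    (P : probability W R) (E : nat -> set W) :
  (forall n, measurable (E n)) ->
  (forall eta : R, 0 < eta -> \forall n \near \oo, (P (E n) <= eta%:E)%E) ->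
  (fun n => P (E n)) @ \oo --> 0%E.
Proof.
move=> mE PE.
have fE n : P (E n) \is a fin_num by exact: fin_num_measure.
apply/fine_cvgP; split; first exact: nearW.
apply/cvgrPdist_le => eta eta0; apply: filterS (PE _ eta0) => n Pn /=.
rewrite sub0r normrN ger0_norm ?fine_ge0//.
by rewrite -lee_fin fineK.
Qed.

Unset Implicit Arguments.

Theorem proposition3p4 (R : realType)
    (H1 H2 : completeNormedModType R)
    (ip1 : {dot H1 for idfun}) (ip2 : {dot H2 for idfun})
    (ip1_norm : induces_norm ip1) (ip2_norm : induces_norm ip2)
    (H1_separable : separable_space H1) (H2_separable : separable_space H2)
    (A : {linear H1 -> H2}) (As : H2 -> H1)
    (A_inj : injective A) (A_cont : continuous A)
    (As_adjoint : adjoint ip1 ip2 A As)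
    (e : nat -> H1) (g : nat -> H2) (rho : nat -> R)
    (e_basis : orthonormal_basis ip1 e)
    (e_eigen : forall k, As (A (e k)) = rho k ^+ 2 *: e k)
    (g_conj : forall k, A (e k) = rho k *: g k)
    (f0 : H1) (gamma beta delta B1 B2 b : R)
    (gamma_gt0 : 0 < gamma) (f0_sobolev : sobolev ip1 e gamma f0)
    (rho_ill_posed : severely_ill_posed rho beta)
    (B1_gt0 : 0 < B1) (B2_gt0 : 0 < B2) (b_gt0 : 0 < b)
    (h : nat -> R) (q : R -> R) (tau : nat -> R)
    (Pi : probability (borel H1) R)
    (Pi_sieve : sieve_prior e h q tau Pi)
    (h_lower : forall m : nat, (0 < m)%N ->
       B1 * expR (- b * m%:R `^ (beta + 1)) <= h m)
    (h_tail : \forall m \near \oo,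
       1 - distribution_function h m <= B2 * expR (- b * m%:R `^ (beta + 1)))
    (q_gaussian : q = normal_pdf 0 1)
    (delta_gt : beta / 2 < delta)
    (tau_def : forall k,
       tau k = (1 + k.+1%:R ^+ 2) `^ (- delta / 2 - 1 / 4)) :
  exists2 C0 : R, 0 < C0 &
  forall C : R, C0 <= C ->
  forall (d : measure_display) (W : measurableType d) (P : probability W R)
         (Z : nat -> H2 -> {RV P >-> R}),
    (forall n, white_noise ip2 (Z n)) ->
    cvg0_in_probability P (fun n w =>
      posterior ip1 e rho A n Pi
        (fun k => observation ip2 (Z n) (A f0) n (g k) w)
        [set f | `|f - f0| >
           C * ln n%:R `^ (- (Num.min (delta - beta / 2) gamma / beta))]).

Proof.
have [e_orth e_cvg] := e_basis.
have ee k : ip1 (e k) (e k) = 1 by rewrite e_orth eqxx.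
have rho_neq0 k : rho k != 0.
  apply/eqP => rk; have Ae0 : A (e k) = A 0 by rewrite g_conj rk scale0r linear0.
  by have := ee k; rewrite (A_inj _ _ Ae0) linear0r => /eqP; rewrite eq_sym oner_eq0.
have Ae_dot x k : ip2 (A x) (A (e k)) = rho k ^+ 2 * ip1 x (e k).
  by rewrite As_adjoint e_eigen dotZr.
have Ae_orth j k : ip2 (A (e j)) (A (e k)) = rho k ^+ 2 * (j == k)%:R.
  by rewrite Ae_dot e_orth.
have Ag_dot x k : ip2 (A x) (g k) = rho k * ip1 x (e k).
  apply: (mulfI (rho_neq0 k)); rewrite -dotZr -g_conj Ae_dot; ring.
have gg k : ip2 (g k) (g k) = 1.
  apply: (mulfI (rho_neq0 k)); rewrite -dotZl -g_conj Ag_dot ee; ring.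
have [K rhoK] : exists K, forall k, rho k ^+ 2 <= K.
  have /linear_boundedP/pinfty_ex_gt0[r r0 Ar] :=
    (linear_bounded_continuous A).2 A_cont.
  exists (r ^+ 2) => k; have := Ar (e k).
  have -> : `|e k| = 1.
    apply/eqP; rewrite -(eqrXn2 (n := 2))// expr1n ip1_norm ee//.
  rewrite mulr1 => /(lerXn2r 2); rewrite !nnegrE normr_ge0 (ltW r0) => /(_ isT isT).
  by rewrite ip2_norm Ae_orth eqxx mulr1.
have beta0 : 0 < beta by case: rho_ill_posed.
pose p := Num.min (delta - beta / 2) gamma.
have p0 : 0 < p by rewrite lt_min subr_gt0 delta_gt gamma_gt0.
pose f k := ip1 f0 (e k).
pose tau_gt0 := scale_gt0 tau_def.
pose tau_le1 := scale_le1 beta0 delta_gt tau_def.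
have [c [c1 [c0 c10 obs]]] := ill_posed_lower beta0 tau_def rho_ill_posed rho_neq0.
have [Sf fS] : exists Sf, forall m,
    \sum_(k < m) f k ^+ 2 * (1 + k.+1%:R ^+ 2) `^ gamma <= Sf.
  exists (fine (sobolev_norm2 ip1 e gamma f0)) => m.
  have norm_ge0 : (0 <= sobolev_norm2 ip1 e gamma f0)%E.
    by apply: nneseries_ge0 => k _ _; rewrite lee_fin mulr_ge0 ?powR_ge0 ?sqr_ge0.
  rewrite -lee_fin fineK ?ge0_fin_numE// -sumEFin.
  apply: (@le_trans _ _ (\sum_(0 <= k < m)
      (`|ip1 f0 (e k)| ^+ 2 * (1 + k.+1%:R ^+ 2) `^ gamma)%:E)%E).
    by rewrite big_mkord; apply: lee_sum => k _; rewrite real_normK ?num_real.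
  apply: nneseries_lim_ge => k _ _.
  by rewrite lee_fin mulr_ge0 ?powR_ge0 ?sqr_ge0.
have p_delta : p <= delta - beta / 2 by rewrite ge_min lexx.
have p_gamma : p <= gamma by rewrite ge_min lexx orbT.
have [Sd energyS] := scale_series_bounded beta0 tau_def p_delta p_gamma fS.
have [dQ [WQ [Q [M [x]]]]] := Pi_sieve; rewrite q_gaussian => -[M0 QM Qx PiQ].
have h_gt0 m : (0 < m)%N -> 0 < h m.
  by move=> m0; rewrite (lt_le_trans _ (h_lower m m0))// mulr_gt0// expR_gt0.
have h_le1 m : (0 < m)%N -> h m <= 1.
  by move=> m0; rewrite -lee_fin -QM//; apply: probability_le1; exact: measurable_level.
have Pi_fin := prior_finitely_supported ip1_norm e_orth PiQ.
exists 1 => // C C1 d W P Z Zwn eps eps0.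
have C0 : 0 < C by exact: lt_le_trans C1.
pose xi n k : {RV P >-> R} := Z n (g k).
have xi2 n k : ('E_P[(fun w => (xi n k w * xi n k w)%R)] = 1)%E.
  by have [_ _ /(_ (g k) (g k))] := Zwn n; rewrite gg.
pose Y n w k := observation ip2 (Z n) (A f0) n (g k) w.
have YE n w k : Y n w k = rho k * f k + (Num.sqrt n%:R)^-1 * xi n k w.
  by rewrite /Y /observation Ag_dot.
have mY n k : measurable_fun setT (fun w => Y n w k).
  by apply: measurable_funD => //; exact: measurable_funM.
pose rate n : R := ln n%:R `^ (- (p / beta)).
pose B n := [set f : H1 | C * rate n < `|f - f0|].
have mB n : measurable (B n : set (borel H1)) by apply: measurable_open; exact: open_far.
pose E n := [set w | (eps%:E < `|posterior ip1 e rho A n Pi (Y n w) (B n)|)%E].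
have EE n : E n = [set w |
    (eps%:E * \int[Pi]_(f in topological_support Pi)
        (likelihood ip1 e rho A n (Y n w) f)%:E <
     \int[Pi]_(f in B n) (likelihood ip1 e rho A n (Y n w) f)%:E)%E].
  apply/funext => w; rewrite /E/=.
  by rewrite (posterior_gt_event ip1_norm ip2_norm H1_separable A_cont e_orth
    Ae_orth tau_gt0 QM Qx PiQ).
have mE n : measurable (E n).
  rewrite EE -[X in measurable X]setTI; apply: measurable_lte => //.
    apply: measurable_funeM.
    exact: (measurable_integral_likelihood ip1_norm A_cont rho Pi_fin n (mY n)
      (measurable_support Pi)).
  exact: (measurable_integral_likelihood ip1_norm A_cont rho Pi_fin n (mY n) (mB n)).
apply: (prob_squeeze0 mE) => zeta zeta0.
(* On the event that the weighted noise stays below kap, the first estimate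
   contributes kap and the rest eta to the bound eps; kap <= 1 also enforces
   the noise budget X. *)
pose kap := Num.min (eps / 2) 1.
have kap0 : 0 < kap by rewrite lt_min ltr01 andbT divr_gt0.
pose eta := Num.min (eps / 2) (kap * zeta / 2).
have eta0 : 0 < eta by rewrite lt_min !divr_gt0//; exact: mulr_gt0.
have resid_sum := residual_sum ip1 e f0.
have resid0 := residual_cvg0 ip1_norm e_orth (e_cvg f0).
have trunc := truncation_level_exists beta0 (ltW p0) b_gt0 B1_gt0 c0 c10 tau_gt0
  tau_le1 rhoK obs energyS h_lower h_le1 resid_sum resid0 eta0.
apply: filterS2 (nbhs_infty_gt 0) trunc => n n0.
move=> [j [theta [u [X [[j0 theta0 u0 X0] [rate0 Sv Rj Zj]]]]]].
have C1' : rate n ^+ 2 <= (C * rate n) ^+ 2.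
  by rewrite exprMn ler_peMl ?sqr_ge0// exprn_ege1.
pose energy k := tau k ^+ 2 + f k ^+ 2.
pose a k := n%:R * rho k ^+ 2 * tau k ^+ 2.
have a0 k : 0 <= a k by rewrite mulr_ge0 ?sqr_ge0// mulr_ge0 ?sqr_ge0.
(* One series of weighted squared noises controls both the posterior risk,
   through v1, and the noise below the level j, through v2. *)
pose v1 k := 12 * (energy k / (1 + a k)) / rate n ^+ 2.
pose v2 k : R := if (k < j)%N then X^-1 else 0.
pose v k := v1 k + v2 k.
have rr0 : 0 < rate n ^+ 2 by rewrite exprn_gt0.
have v10 k : 0 <= v1 k.
  rewrite divr_ge0 ?sqr_ge0// mulr_ge0// divr_ge0 ?addr_ge0 ?sqr_ge0//.
have v20 k : 0 <= v2 k by rewrite /v2; case: ifP => // _; rewrite invr_ge0 ltW.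
have v0 k : 0 <= v k by rewrite addr_ge0.
have EV : E n `<=` [set w | (kap%:E <= weighted_squares (xi n) v w)%E].
  move=> w; rewrite EE/=; apply: contraPP => /negP; rewrite -ltNge => Vk.
  have Vm m : \sum_(k < m) v k * (1 + xi n k w ^+ 2) <= kap.
    rewrite -lee_fin -sumEFin; apply: le_trans (ltW Vk).
    rewrite -(big_mkord xpredT (fun k => (v k * (1 + xi n k w ^+ 2))%:E)).
    apply: nneseries_lim_ge => k _ _.
    by rewrite lee_fin mulr_ge0// addr_ge0// sqr_ge0.
  have xi_ge0 k : 0 <= 1 + xi n k w ^+ 2 by rewrite addr_ge0// sqr_ge0.
  have kap1 : kap <= 1 by rewrite ge_min lexx orbT.
  have kap_eps : kap <= eps / 2 by rewrite ge_min lexx.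
  have eta_eps : eta <= eps / 2 by rewrite ge_min lexx.
  have xiX : \sum_(k < j) xi n k w ^+ 2 <= X.
    rewrite -[leRHS]mulr1 -ler_pdivrMl// mulr_sumr.
    apply: le_trans kap1; apply: le_trans (Vm j); apply: ler_sum => k _.
    apply: (@le_trans _ _ (X^-1 * (1 + xi n k w ^+ 2))).
      by rewrite ler_wpM2l ?invr_ge0 ?(ltW X0)// lerDr.
    by rewrite ler_wpM2r// /v /v2 ltn_ord lerDr.
  have risk m : \sum_(k < m)
      (12 * tilt_sd (tau k) (n%:R * rho k ^+ 2) ^+ 2 +
       2 * (tilt_mean (tau k) (n%:R * rho k ^+ 2) (n%:R * rho k * Y n w k) -
            ip1 f0 (e k)) ^+ 2) <= kap * rate n ^+ 2.
    rewrite -ler_pdivrMr// mulr_suml; apply: le_trans (Vm m).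
    apply: ler_sum => k _; rewrite YE.
    apply: (@le_trans _ _ (v1 k * (1 + xi n k w ^+ 2))); last first.
      by rewrite ler_wpM2r// lerDl.
    rewrite /v1 [leRHS]mulrAC ler_pM2r ?invr_gt0//.
    exact: (tilt_risk_le (rho k) (tau k) (f k) (xi n k w) n0).
  have mass m : (0 < m < j)%N ->
      residual ip1 e f0 j + theta < residual ip1 e f0 m ->
      h m * \prod_(k < m) tilt_mass (tau k) (n%:R * rho k ^+ 2)
        (n%:R * rho k * Y n w k) <=
      u * (h j * \prod_(k < j) tilt_mass (tau k) (n%:R * rho k ^+ 2)
        (n%:R * rho k * Y n w k)).
    move=> mj Rm; have /= := Zj (fun k => xi n k w) xiX m mj Rm.
    by under eq_bigr do rewrite -YE; under [in leRHS]eq_bigr do rewrite -YE.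
  have Crate0 : 0 < C * rate n by rewrite mulr_gt0.
  have far := integral_likelihood_far ip1_norm ip2_norm H1_separable A_cont e_orth
    Ae_orth tau_gt0 M0 QM Qx PiQ h_gt0 Crate0 j0 theta0 u0 risk mass.
  apply/negP; rewrite -leNgt; apply: le_trans far _.
  apply: lee_wpmul2r.
    by apply: integral_ge0 => f' _; rewrite lee_fin; exact: likelihood_ge0.
  rewrite lee_fin; apply: (@le_trans _ _ (kap + eta)); last by lra.
  apply: (@le_trans _ _ (kap +
      ((residual ip1 e f0 j + theta) / rate n ^+ 2 + j%:R * u))); last first.
    by rewrite lerD2l.
  rewrite [leRHS]addrA lerD2r -addrA.
  have Rth0 : 0 <= residual ip1 e f0 j + theta.
    by rewrite addr_ge0//; exact: residual_ge0.
  apply: (@le_trans _ _ ((kap * rate n ^+ 2 + (residual ip1 e f0 j + theta)) / rate n ^+ 2)).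
    apply: ler_wpM2l; last by rewrite lef_pV2 ?posrE// exprn_gt0.
    by rewrite addr_ge0// mulr_ge0// ltW.
  by rewrite mulrDl mulfK// gt_eqF.
apply: (@le_trans _ _ (P [set w | (kap%:E <= weighted_squares (xi n) v w)%E])).
  apply: le_measure => //; rewrite inE//.
  rewrite -[X in measurable X]setTI; apply: measurable_lee => //.
  exact: measurable_weighted_squares.
apply: le_trans (prob_weighted_squares_ge (xi2 n) v0 kap0 Sv) _.
rewrite lee_fin ler_pdivrMr//.
have : eta <= kap * zeta / 2 by rewrite ge_min lexx orbT.
lra.
Qed.
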